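(* For every $t,k\in\mathbb{N}$ there exist $C,m_0,N\in\mathbb{N}$ such that if $\mathcal{F}\subset[m]^n$ is $(t-1)$-avoiding with $m\ge m_0$ and $n\ge N\log m$, then there is a $t$-intersecting collection $\mathcal{D}$ of at most $C$ subcubes of co-dimension at most $k$ such that $\mu(\mathcal{F}\setminus\bigcup\mathcal{D})\le Cm^{-k}$.
   Context: $\mu$ is the uniform probability measure on $[m]^n$; ${\sf agr}(x,y)=|\{i:x_i=y_i\}|$; $\mathcal{F}$ is $(t-1)$-avoiding if no $x,y\in\mathcal{F}$ have ${\sf agr}(x,y)=t-1$. A subcube of co-dimension $|R|$ is $D_{R\to\alpha}=\{x\in[m]^n:x_R=\alpha\}$ for $R\subset[n]$, $\alpha\in[m]^R$; $\bigcup\mathcal{D}$ is the union of the subcubes in $\mathcal{D}$. A collection $\mathcal{D}$ of subcubes is $t$-intersecting if for any (not necessarily distinct) $D_{R\to\alpha},D_{R'\to\beta}\in\mathcal{D}$ we have $|\{i\in R\cap R':\alpha_i=\beta_i\}|\ge t$. *)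

(* Defs.v *)
From Stdlib Require Import Reals.
From mathcomp Require Import all_boot.
Set Implicit Arguments. Unset Strict Implicit. Unset Printing Implicit Defensive.

Notation cube m n := {ffun 'I_n -> 'I_m}.

Definition agr (m n : nat) (x y : cube m n) : nat := #|[set i | x i == y i]|.

Definition mu (m n : nat) (A : {set cube m n}) : R :=
  Rdiv (INR #|A|) (INR (m ^ n)%N).

(* F is (t-1)-avoiding: no x,y in F with agr(x,y) = t-1 (as integers;
   for t = 0 this is vacuous) *)
Definition avoiding (m n t : nat) (F : {set cube m n}) : Prop :=
  forall x y, x \in F -> y \in F -> (agr x y).+1 != t.

(* A subcube D_{R -> alpha} is encoded by (R, alpha) with alpha a full
   function; only alpha restricted to R matters. *)
Definition subcube_t (m n : nat) : Type := ({set 'I_n} * cube m n)%type.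

Definition subcube (m n : nat) (D : subcube_t m n) : {set cube m n} :=
  [set x : cube m n | [forall i in D.1, x i == D.2 i]].

Definition codim (m n : nat) (D : subcube_t m n) : nat := #|D.1|.

Definition bigcup_sub (m n : nat) (Ds : seq (subcube_t m n)) : {set cube m n} :=
  \bigcup_(D <- Ds) subcube D.

Definition t_intersecting (m n t : nat) (Ds : seq (subcube_t m n)) : Prop :=
  forall D D', D \in Ds -> D' \in Ds ->
    t <= #|[set i in D.1 :&: D'.1 | D.2 i == D'.2 i]|.

(* Main.v *)
Require Import Defs.
From Stdlib Require Import Reals.
From mathcomp Require Import all_boot all_order all_algebra.
From mathcomp Require Import ring lra zify.
Set Implicit Arguments. Unset Strict Implicit. Unset Printing Implicit Defensive.
Import Order.TTheory GRing.Theory Num.Theory.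
Local Open Scope ring_scope.

(** A [(t-1)]-avoiding family is split along a bounded tree of subcubes: either few dictators
    [x_i = a] capture a node up to measure [m^-k] and one branches on them, or the node is
    "uncapturable". What remains is to see that two uncapturable subcubes agree on [t] fixed
    coordinates. Otherwise, restrict both pieces so that they become spread (fixing [d] further
    coordinates multiplies the density by at most a small power [b^d] of [m]), avoiding all
    accidental agreements by deleting dictators. Since [n >= N log m], a Chernoff bound shows that
    most one-coordinate marginals are close to uniform, so the missing number of agreements can be
    fixed by hand, and it remains to find everywhere-disagreeing points in two spread functions.
    The disagreement operator has eigenvalues [(-1/(m-1))^d], so this follows from an upper bound
    for the noise stability of a spread function. That bound is self-improving: take the
    derivative of extremal normalised stability, estimate it by Hoelder against a [2p]-norm of its
    noisy version, and use global hypercontractivity to express this norm by the stabilities of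
    further derivatives. *)

(** * A one-coordinate moment inequality *)

Section OneStep.
Variable R : realFieldType.

(** When a constant plus a fluctuation is squared, [a] and [b] are the two squares and [z] is the
    cross term, so [z ^+ 2 <= 4 * (a * b)] is Cauchy-Schwarz. On the right [z] occurs only linearly,
    because it will average to zero. *)
Definition decoupling_constant (p C : nat) : Prop := forall a z b : R,
  0 <= a -> 0 <= b -> z ^+ 2 <= 4 * (a * b) ->
  (a + z + b) ^+ p.+1 <=
  a ^+ p.+1 + p.+1%:R * (a ^+ p * z) + C%:R * (a ^+ p * b) + C%:R * b ^+ p.+1.

(** Induction on [p], multiplying by [a + z + b]: the hypothesis trades [z ^+ 2] for [a * b], and
    the remaining mixed monomials lie below sums of the two extreme ones. *)
Lemma exists_decoupling_constant (p : nat) : exists C : nat, decoupling_constant p C.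
Proof.
elim: p => [|p [C IH]].
  exists 1%N => a z b a0 b0 _; rewrite !expr1 !expr0; lra.
(* The expansion uses about [6 * C + 6 * p + 7] copies of the extreme monomials; the rest is
   slack. *)
exists (8 * C + 6 * p + 20)%N => a z b a0 b0 hz.
have zab : `|z| <= a + b.
  rewrite -(ler_pXn2r (n := 2)) ?nnegrE ?addr_ge0 ?normr_ge0 //.
  rewrite real_normK ?num_real //; apply: (le_trans hz).
  have := sqr_ge0 (a - b); nra.
have [zl zu] : - (a + b) <= z /\ z <= a + b by move: zab; rewrite ler_norml => /andP[].
have s0 : 0 <= a + z + b by lra.
rewrite exprSr; apply: (le_trans (ler_wpM2r s0 (IH a z b a0 b0 hz))).
rewrite !natrD.
have C0 : 0 <= C%:R :> R by rewrite ler0n.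
have p0 : 0 <= p%:R :> R by rewrite ler0n.
rewrite (exprSr _ p.+1) (exprSr a p) (exprSr b p.+1) (exprSr b p) -[p.+2]addn2 -[p.+1]addn1 !natrD.
set P : R := a ^+ p; set Q : R := b ^+ p; set c : R := C%:R; set n : R := p%:R.
have P0 : 0 <= P by rewrite exprn_ge0.
have Q0 : 0 <= Q by rewrite exprn_ge0.
(* a^(p+1) b dominates or b^(p+2) dominates the mixed terms *)
have mix1 : P * b * b <= P * a * b + Q * b * b.
  case: (leP b a) => ab.
    have : P * b * b <= P * a * b by rewrite ler_wpM2r // ler_wpM2l.
    have := mulr_ge0 (mulr_ge0 Q0 b0) b0; lra.
  have : P * b * b <= Q * b * b.
    by rewrite !ler_wpM2r // /P /Q lerXn2r ?nnegrE // ltW.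
  have := mulr_ge0 (mulr_ge0 P0 a0) b0; lra.
have mix2 : Q * b * a <= P * a * b + Q * b * b.
  case: (leP b a) => ab.
    have : Q * b * a <= P * b * a.
      by rewrite !ler_wpM2r // /P /Q lerXn2r ?nnegrE.
    have := mulr_ge0 (mulr_ge0 Q0 b0) b0; lra.
  have : Q * b * a <= Q * b * b by rewrite ler_wpM2l ?mulr_ge0 // ltW.
  have := mulr_ge0 (mulr_ge0 P0 a0) b0; lra.
have Pz2 : P * z * z <= 4 * (P * a * b).
  have := ler_wpM2l P0 hz; rewrite expr2; lra.
have Pzb : P * z * b <= P * a * b + P * b * b.
  have : P * b * z <= P * b * (a + b) by rewrite ler_wpM2l ?mulr_ge0.
  lra.
have Pbs : P * b * (a + z + b) <= 2 * (P * a * b) + 2 * (P * b * b).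
  have : P * b * z <= P * b * (a + b) by rewrite ler_wpM2l ?mulr_ge0.
  lra.
have Qbs : Q * b * (a + z + b) <= 2 * (Q * b * a) + 2 * (Q * b * b).
  have : Q * b * z <= Q * b * (a + b) by rewrite ler_wpM2l ?mulr_ge0.
  lra.
have n1 : 0 <= n + 1 by rewrite addr_ge0.
have h1 := ler_wpM2l n1 Pz2.
have h2 := ler_wpM2l n1 Pzb.
have h3 := ler_wpM2l C0 Pbs.
have h4 := ler_wpM2l C0 Qbs.
have h5 := ler_wpM2l n1 mix1.
have h6 := ler_wpM2l C0 mix1.
have h7 := ler_wpM2l C0 mix2.
have t1 := mulr_ge0 (mulr_ge0 P0 a0) b0.
have t2 := mulr_ge0 (mulr_ge0 Q0 b0) b0.
have u1 := mulr_ge0 C0 t1; have u2 := mulr_ge0 C0 t2.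
have v1 := mulr_ge0 p0 t1; have v2 := mulr_ge0 p0 t2.
rewrite -/c -/n in h1 h2 h3 h4 h5 h6 h7 u1 u2 v1 v2 *.
have -> : (P * a + (n + 1) * (P * z) + c * (P * b) + c * (Q * b)) * (a + z + b)
  = P * a * a + (n + 2) * (P * a * z) + P * a * b + (n + 1) * (P * z * z)
    + (n + 1) * (P * z * b) + c * (P * b * (a + z + b)) + c * (Q * b * (a + z + b)) by ring.
lra.
Qed.

End OneStep.

(** * Averages and the vector-valued one-coordinate inequality *)

Section OneStep2.
Variable R : realFieldType.

Lemma bernoulliS (p : nat) (a x : R) : 0 <= a -> 0 <= x ->
  a ^+ p.+1 + a ^+ p * x <= (a + x) ^+ p.+1.
Proof.
move=> a0 x0; rewrite !exprSr -mulrDr ler_wpM2r ?addr_ge0 //.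
by rewrite lerXn2r ?nnegrE ?addr_ge0 // lerDl.
Qed.

Lemma wcauchy (J : finType) (w c g : J -> R) : (forall j, 0 <= w j) ->
  (\sum_j w j * (c j * g j)) ^+ 2 <=
  (\sum_j w j * c j ^+ 2) * (\sum_j w j * g j ^+ 2).
Proof.
move=> w0.
set X := \sum_j w j * (c j * g j); set P := \sum_j w j * c j ^+ 2.
set Q := \sum_j w j * g j ^+ 2.
have H (s t : R) : 0 <= s ^+ 2 * P + 2 * s * t * X + t ^+ 2 * Q.
  have -> : s ^+ 2 * P + 2 * s * t * X + t ^+ 2 * Q =
            \sum_j w j * (s * c j + t * g j) ^+ 2.
    rewrite /P /X /Q !mulr_sumr -!big_split /=; apply: eq_bigr => j _; ring.
  by apply: sumr_ge0 => j _; rewrite mulr_ge0 ?sqr_ge0.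
have P0 : 0 <= P by apply: sumr_ge0 => j _; rewrite mulr_ge0 ?sqr_ge0.
have Q0 : 0 <= Q by apply: sumr_ge0 => j _; rewrite mulr_ge0 ?sqr_ge0.
case: (eqVneq P 0) => [P_eq|Pn].
  (* For [P = 0] the quadratic form at [(- (Q + 1), X)] equals [- (Q + 2) * X ^+ 2], which forces
     [X = 0]. *)
  have h := H (- (Q + 1)) X; rewrite P_eq mul0r.
  have := H (- (Q + 1)) X; rewrite P_eq.
  have -> : (- (Q + 1)) ^+ 2 * 0 + 2 * - (Q + 1) * X * X + X ^+ 2 * Q =
    - ((Q + 2) * X ^+ 2) by ring.
  rewrite oppr_ge0 => h2; have := sqr_ge0 X => x2.
  have : 0 <= Q * X ^+ 2 by rewrite mulr_ge0.
  lra.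
have Pp : 0 < P by rewrite lt_def Pn.
have := H (- X) P; have -> : (- X) ^+ 2 * P + 2 * - X * P * X + P ^+ 2 * Q =
  P * (P * Q - X ^+ 2) by ring.
by rewrite pmulr_rge0 // subr_ge0.
Qed.

Definition favg (A : finType) (F : A -> R) : R := #|A|%:R^-1 * \sum_a F a.

Lemma favg_ge0 (A : finType) (F : A -> R) : (forall a, 0 <= F a) -> 0 <= favg F.
Proof. by move=> h; rewrite mulr_ge0 ?invr_ge0 ?ler0n // sumr_ge0. Qed.

Lemma le_favg (A : finType) (F G : A -> R) : (forall a, F a <= G a) -> favg F <= favg G.
Proof. by move=> h; rewrite ler_wpM2l ?invr_ge0 ?ler0n // ler_sum. Qed.

Lemma favgD (A : finType) (F G : A -> R) :
  favg (fun a => F a + G a) = favg F + favg G.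
Proof. by rewrite /favg big_split mulrDr. Qed.

Lemma favgZ (A : finType) c (F : A -> R) : favg (fun a => c * F a) = c * favg F.
Proof. by rewrite /favg -mulr_sumr mulrCA. Qed.

Lemma favg_cst (A : finType) (c : R) : (0 < #|A|)%N -> favg (fun _ : A => c) = c.
Proof.
move=> A0; rewrite /favg sumr_const -(mulr_natl c) mulrA mulVf ?mul1r //.
by rewrite pnatr_eq0 -lt0n.
Qed.

Lemma eq_favg (A : finType) (F G : A -> R) : F =1 G -> favg F = favg G.
Proof. by move=> h; congr (_ * _); apply: eq_bigr. Qed.

Lemma favg_sum (A J : finType) (P : pred J) (F : A -> J -> R) :
  favg (fun a => \sum_(j | P j) F a j) = \sum_(j | P j) favg (fun a => F a j).
Proof. by rewrite /favg exchange_big mulr_sumr. Qed.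

(** The decoupling inequality is applied pointwise in a weighted l2 space. Averaging kills the cross
    term, and [bernoulliS] pushes the term linear in the fluctuation's energy back into the
    power. *)
Lemma vector_step (p C : nat) (HC : decoupling_constant R p C)
  (J A : finType) (w c : J -> R) (g : J -> A -> R) :
  (0 < #|A|)%N -> (forall j, 0 <= w j) -> (forall j, favg (g j) = 0) ->
  favg (fun a => (\sum_j w j * (c j + g j a) ^+ 2) ^+ p.+1) <=
  (\sum_j w j * c j ^+ 2 + C%:R * favg (fun a => \sum_j w j * g j a ^+ 2)) ^+ p.+1
  + C%:R * favg (fun a => (\sum_j w j * g j a ^+ 2) ^+ p.+1).
Proof.
move=> A0 w0 g0.
set a0 := \sum_j w j * c j ^+ 2.
have a00 : 0 <= a0 by apply: sumr_ge0 => j _; rewrite mulr_ge0 ?sqr_ge0.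
pose z a := \sum_j w j * (c j * g j a); pose b a := \sum_j w j * g j a ^+ 2.
have b0 a : 0 <= b a by apply: sumr_ge0 => j _; rewrite mulr_ge0 ?sqr_ge0.
have zavg : favg z = 0.
  rewrite /z favg_sum big1 // => j _; rewrite favgZ favgZ g0; ring.
have E a : \sum_j w j * (c j + g j a) ^+ 2 = a0 + 2 * z a + b a.
  rewrite /a0 /z /b mulr_sumr -!big_split /=; apply: eq_bigr => j _; ring.
have step a : (\sum_j w j * (c j + g j a) ^+ 2) ^+ p.+1 <=
   a0 ^+ p.+1 + (p.+1%:R * a0 ^+ p * 2) * z a + (C%:R * a0 ^+ p) * b a
    + C%:R * b a ^+ p.+1.
  rewrite E; have h : (2 * z a) ^+ 2 <= 4 * (a0 * b a).
    have := wcauchy c (g ^~ a) w0; rewrite -/(z a) -/a0 -/(b a) => h; lra.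
  apply: (le_trans (HC _ _ _ a00 (b0 a) h)); rewrite le_eqVlt; apply/orP; left.
  by apply/eqP; ring.
apply: (le_trans (le_favg step)).
rewrite !favgD !favgZ favg_cst // zavg mulr0 addr0 lerD2r.
have hb : 0 <= C%:R * favg b by rewrite mulr_ge0 ?ler0n // favg_ge0.
apply: le_trans (bernoulliS p a00 hb).
by rewrite lerD2l -/b [leRHS]mulrCA mulrA.
Qed.
End OneStep2.

(** * Product kernels on [{ffun I -> A}] *)

Section Kernel.
Variables (R : realFieldType) (I A : finType).
Local Notation X := {ffun I -> A}.
Implicit Types (k : I -> A -> A -> R) (f g h : X -> R) (U V W P S : {set I}).

(** Averaging, projections, noise and Laplacians are all tensor products of one-coordinate kernels,
    so through [kopM] operator identities reduce to identities for kernels on [A]. *)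
Definition kop k f (x : X) : R := \sum_(y : X) (\prod_i k i (x i) (y i)) * f y.

Lemma eq_kop k k' f x : (forall i a b, k i a b = k' i a b) -> kop k f x = kop k' f x.
Proof. by move=> h; apply: eq_bigr => y _; congr (_ * _); apply: eq_bigr. Qed.

Lemma eq_kopr k f f' x : f =1 f' -> kop k f x = kop k f' x.
Proof. by move=> h; apply: eq_bigr => y _; rewrite h. Qed.

Lemma kopM k k' f x :
  kop k (kop k' f) x = kop (fun i a b => \sum_c k i a c * k' i c b) f x.
Proof.
rewrite /kop; under eq_bigr => y _ do rewrite mulr_sumr.
rewrite exchange_big; apply: eq_bigr => z _.
under eq_bigr => y _ do rewrite mulrA -big_split.
by rewrite -mulr_suml bigA_distr_bigA.
Qed.

Definition idk (a b : A) : R := (a == b)%:R.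
Definition ek (a b : A) : R := #|A|%:R^-1.
(** The orthogonal projection onto mean-zero functions of one coordinate. *)
Definition lk (a b : A) : R := idk a b - ek a b.

Lemma prod_idk (x y : X) : \prod_i idk (x i) (y i) = (x == y)%:R.
Proof.
case: eqP => [->|ne]; first by rewrite big1 // => i _; rewrite /idk eqxx.
have [i hi] : exists i, x i != y i.
  apply/existsP; rewrite -negb_forall; apply/negP => /forallP h.
  by case: ne; apply/ffunP => i; apply/eqP.
by rewrite (bigD1 i) //= /idk (negPf hi) mul0r.
Qed.

Lemma kop_id f x : kop (fun=> idk) f x = f x.
Proof.
rewrite /kop (bigD1 x) //= prod_idk eqxx mul1r big1 ?addr0 // => y ne.
by rewrite prod_idk eq_sym (negPf ne) mul0r.
Qed.

Hypothesis A_gt0 : (0 < #|A|)%N.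

Let q_neq0 : #|A|%:R != 0 :> R.
Proof. by rewrite pnatr_eq0 -lt0n. Qed.

Lemma cube_card_gt0 : (0 < #|{: X}|)%N.
Proof. by rewrite card_ffun expn_gt0 A_gt0. Qed.

Lemma sum_idkl (k : A -> A -> R) a b : \sum_c idk a c * k c b = k a b.
Proof.
rewrite (bigD1 a) //= /idk eqxx mul1r big1 ?addr0 // => c ne.
by rewrite eq_sym (negPf ne) mul0r.
Qed.

Lemma sum_idkr (k : A -> A -> R) a b : \sum_c k a c * idk c b = k a b.
Proof.
rewrite (bigD1 b) //= /idk eqxx mulr1 big1 ?addr0 // => c ne.
by rewrite (negPf ne) mulr0.
Qed.

Lemma sum_idk a : \sum_b idk a b = 1.
Proof.
rewrite (bigD1 a) //= /idk eqxx big1 ?addr0 // => c ne.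
by rewrite eq_sym (negPf ne).
Qed.

Lemma sum_ek a : \sum_b ek a b = 1.
Proof. by rewrite sumr_const -[X in X *+ _]mul1r -mulrnAl mulfV. Qed.

Lemma sum_lk a : \sum_b lk a b = 0.
Proof. by rewrite sumrB sum_idk sum_ek subrr. Qed.

Lemma idkC a b : idk a b = idk b a. Proof. by rewrite /idk eq_sym. Qed.
Lemma lkC a b : lk a b = lk b a. Proof. by rewrite /lk idkC. Qed.

Lemma ek_ek a b : \sum_c ek a c * ek c b = ek a b.
Proof. by rewrite -mulr_suml sum_ek mul1r. Qed.

Lemma ek_lk a b : \sum_c ek a c * lk c b = 0.
Proof. by rewrite -mulr_sumr; under eq_bigr do rewrite lkC; rewrite sum_lk mulr0. Qed.

Lemma lk_ek a b : \sum_c lk a c * ek c b = 0.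
Proof. by rewrite -mulr_suml sum_lk mul0r. Qed.

Lemma lk_lk a b : \sum_c lk a c * lk c b = lk a b.
Proof.
rewrite {1}/lk; under eq_bigr do rewrite mulrBl.
by rewrite sumrB (sum_idkl lk) ek_lk subr0.
Qed.

Lemma favg_kop f x : favg f = kop (fun=> ek) f x.
Proof.
rewrite /favg /kop mulr_sumr; apply: eq_bigr => y _; congr (_ * _).
by rewrite prodr_const card_ffun natrX exprVn.
Qed.

Definition glue U (x y : X) : X := [ffun i => if i \in U then x i else y i].

Lemma glueE U x y i : glue U x y i = if i \in U then x i else y i.
Proof. by rewrite ffunE. Qed.

Lemma glue_glue U V x y z :
  glue U x (glue V y z) = glue (U :|: V) (glue U x y) z.
Proof. by apply/ffunP => i; rewrite !glueE inE; case: (i \in U). Qed.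

(** Freezing [U] at [x] puts a Dirac mass there, so only the row sums of [k] survive on [U]: row sum
    1 gives [kop_glue1], row sum 0 gives [kop_glue0]. *)
Lemma kop_glue k U x f y :
  kop k (fun z => f (glue U x z)) y =
  \sum_(t : X) (\prod_i (if i \in U then (\sum_c k i (y i) c) * idk (x i) (t i)
                   else k i (y i) (t i))) * f t.
Proof.
under eq_kopr => z do rewrite -[f _]kop_id.
rewrite /kop; under eq_bigr => z _ do rewrite mulr_sumr.
rewrite exchange_big; apply: eq_bigr => t _.
under eq_bigr => z _ do rewrite mulrA -big_split /=.
rewrite -mulr_suml; congr (_ * _).
transitivity (\sum_(z : X) \prod_i (k i (y i) (z i) *
    idk (if i \in U then x i else z i) (t i))).
  by apply: eq_bigr => z _; apply: eq_bigr => i _; rewrite glueE.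
rewrite -(bigA_distr_bigA (fun i c => k i (y i) c * idk (if i \in U then x i else c) (t i))).
apply: eq_bigr => i _; case: ifP => iU; first by rewrite mulr_suml.
by rewrite (sum_idkr (k i)).
Qed.

Lemma kop_glue1 k U x f y : (forall i a, i \in U -> \sum_c k i a c = 1) ->
  kop k (fun z => f (glue U x z)) y =
  kop (fun i => if i \in U then idk else k i) f (glue U x y).
Proof.
move=> h; rewrite kop_glue; apply: eq_bigr => t _; congr (_ * _).
by apply: eq_bigr => i _; rewrite glueE; case: ifP => // iU; rewrite h // mul1r.
Qed.

Lemma kop_glue0 k U x f y i : i \in U -> (forall a, \sum_c k i a c = 0) ->
  kop k (fun z => f (glue U x z)) y = 0.
Proof.
move=> iU h; rewrite kop_glue big1 // => t _.
by rewrite (bigD1 i) //= iU h !mul0r.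
Qed.

(** Conditional expectation given the coordinates in [U]; for an indicator, the density in the
    subcube that fixes [U] as [x] does. *)
Definition cond U f x := favg (fun y => f (glue U x y)).

Lemma condE U f x : cond U f x = kop (fun i => if i \in U then idk else ek) f x.
Proof.
rewrite /cond (favg_kop _ x) kop_glue1 => [|i a _]; last exact: sum_ek.
by congr kop; apply/ffunP => i; rewrite glueE if_same.
Qed.

Lemma cond_cond U V f x : cond U (cond V f) x = cond (U :&: V) f x.
Proof.
rewrite !condE; under eq_kopr => y do rewrite condE.
rewrite kopM; apply: eq_kop => i a b; rewrite inE.
case: ifP => iU; first by rewrite (sum_idkl (if i \in V then idk else ek)).
case: ifP => iV; last exact: ek_ek.
by rewrite (sum_idkr ek).
Qed.

Lemma favg_cond U f : favg (cond U f) = favg f.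
Proof.
case: (pickP (fun _ : X => true)) => [x _|h]; last first.
  by have := cube_card_gt0; rewrite (eq_card0 h).
have E g : favg g = cond set0 g x.
  by rewrite condE (favg_kop _ x); apply: eq_kop => i a b; rewrite inE.
by rewrite !E cond_cond set0I.
Qed.

Lemma cond_glue U V f x y : U \subset V -> cond U f (glue V x y) = cond U f x.
Proof.
move=> UV; rewrite /cond; apply: eq_favg => z; congr f; apply/ffunP => i.
by rewrite !glueE; case: ifP => // /(subsetP UV) ->.
Qed.

Lemma cond_ge0 U f x : (forall y, 0 <= f y) -> 0 <= cond U f x.
Proof. by move=> h; apply: favg_ge0. Qed.

Lemma le_cond U f g x : (forall y, f y <= g y) -> cond U f x <= cond U g x.
Proof. by move=> h; apply: le_favg. Qed.

End Kernel.

(** * Hypercontractivity *)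

Section SubsetSums.
Variables (R : realFieldType) (I : finType).
Implicit Types (U P : {set I}) (F : {set I} -> R).

Lemma sum_interval_add1 (i : I) U P F : i \notin P -> i \notin U ->
  \sum_(W : {set I} | (i |: U \subset W) && (W \subset i |: P)) F W =
  \sum_(W : {set I} | (U \subset W) && (W \subset P)) F (i |: W).
Proof.
move=> iP iU.
rewrite (reindex_onto (fun W => i |: W) (fun W => W :\ i)) /=; last first.
  by move=> W /andP[UW _]; rewrite setD1K // (subsetP UW) ?setU11.
apply: eq_bigl => W; case: (boolP (i \in W)) => iW.
  have -> : W \subset P = false by apply: contraNF iP => /subsetP ->.
  rewrite andbF; apply/negP => /andP[_ /eqP h].
  by have := setD11 i (i |: W); rewrite h iW.
rewrite setU1K // eqxx andbT.
have in1 (S T : {set I}) : i \notin S -> i \notin T ->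
    (i |: S \subset i |: T) = (S \subset T).
  move=> iS iT; apply/subsetP/subsetP => h j jS.
    have := h j; rewrite !inE jS orbT => /(_ isT) /orP[/eqP ji|//].
    by rewrite -ji jS in iS.
  by move: jS; rewrite !inE => /orP[->//|/h ->]; rewrite orbT.
by rewrite !in1.
Qed.

Lemma sum_interval_split (i : I) U P F : i \notin P -> i \notin U ->
  \sum_(W : {set I} | (U \subset W) && (W \subset i |: P)) F W =
  \sum_(W : {set I} | (U \subset W) && (W \subset P)) F W +
  \sum_(W : {set I} | (U \subset W) && (W \subset P)) F (i |: W).
Proof.
move=> iP iU.
rewrite (bigID (fun W : {set I} => i \in W)) /= addrC; congr (_ + _).
  apply: eq_bigl => W; rewrite -andbA; congr (_ && _).
  apply/andP/idP => [[/subsetP h iW]|/subsetP h].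
    apply/subsetP => j jW; move: (h j jW); rewrite !inE => /orP[/eqP ji|//].
    by rewrite -ji jW in iW.
  split; last by apply: contra iP => /h.
  by apply/subsetP => j /h jP; rewrite inE jP orbT.
rewrite -sum_interval_add1 //; apply: eq_bigl => W.
by rewrite subUset sub1set andbC andbA.
Qed.
End SubsetSums.

(** * Decoupling the coordinates one at a time *)

Section Hybrid.
Variables (R : realFieldType) (I A : finType).
Local Notation X := {ffun I -> A}.
Implicit Types (f g h : X -> R) (U V W P S : {set I}).
Hypothesis A_gt0 : (0 < #|A|)%N.

(** [W] takes precedence over [P]: with [P = setT] this gives the Efron-Stein component of [W], with
    [P = set0] the Laplacian in the directions [W]. *)
Definition pker P W : I -> A -> A -> R :=
  fun i => if i \in W then @lk R A else if i \in P then @ek R A else @idk R A.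

Lemma kopDl i (k k1 k2 : I -> A -> A -> R) f x :
  (forall a b, k i a b = k1 i a b + k2 i a b) ->
  (forall j, j != i -> k1 j = k j /\ k2 j = k j) ->
  kop k f x = kop k1 f x + kop k2 f x.
Proof.
move=> hi hj; rewrite /kop -big_split; apply: eq_bigr => y _ /=; rewrite -mulrDl.
congr (_ * _); rewrite !(bigD1 (P := predT) i) //= hi mulrDl.
by congr (_ * _ + _ * _); apply: eq_bigr => j ji; case: (hj j ji) => h1 h2; rewrite ?h1 ?h2.
Qed.

Lemma kop_split i P W f x : i \notin P -> W \subset P ->
  kop (pker P W) f x = kop (pker (i |: P) W) f x + kop (pker (i |: P) (i |: W)) f x.
Proof.
move=> iP WP; have iW : i \notin W by apply: contra iP; apply: (subsetP WP).
apply: (kopDl (i := i)) => [a b|j ji].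
  by rewrite /pker (negPf iP) (negPf iW) !setU11 /lk addrC subrK.
by rewrite /pker !inE (negPf ji).
Qed.

(* Halfway through the decoupling: the coordinates outside [P] are untouched, those in [U]
   stay inside the outer power, those in [P :\: U] have been averaged in L2. *)
Definition hybrid (C : R) P U f x : R := cond (~: (P :\: U)) (fun z =>
  \sum_(W : {set I} | (U \subset W) && (W \subset P))
     C ^+ #|W :\: U| * kop (pker P W) f z ^+ 2) x.


Lemma kop_zero_factor i (k : I -> A -> A -> R) f x :
  (forall a b, k i a b = 0) -> kop k f x = 0.
Proof.
by move=> h; rewrite /kop big1 // => y _; rewrite (bigD1 i) //= h !mul0r.
Qed.

Lemma cond_lk i P W f x : cond (~: [set i]) (kop (pker P (i |: W)) f) x = 0.
Proof.
rewrite condE // kopM; apply: (kop_zero_factor (i := i)) => a b.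
by rewrite /pker !inE eqxx /= ek_lk.
Qed.

Lemma kop_ek_glue i P W f x y : i \in P -> i \notin W ->
  kop (pker P W) f (glue (~: [set i]) x y) = kop (pker P W) f x.
Proof.
move=> iP iW; apply: eq_bigr => t _; congr (_ * _); apply: eq_bigr => j _.
rewrite glueE !inE; case: eqVneq => //= ->.
by rewrite /pker (negPf iW) iP.
Qed.

(** With all coordinates but [i] frozen, [kop_split] writes each component as a part constant in [i]
    plus a part of mean zero in [i], as [vector_step] wants. Of its two outputs, one averages [i] in
    L2 inside the power, the other keeps [i] in the outer power. *)
Lemma hybrid_step (p C : nat) (HC : decoupling_constant R p C) i P U f :
  i \notin P -> U \subset P ->
  favg (fun x => hybrid C%:R P U f x ^+ p.+1) <=
  favg (fun x => hybrid C%:R (i |: P) U f x ^+ p.+1) +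
  C%:R * favg (fun x => hybrid C%:R (i |: P) (i |: U) f x ^+ p.+1).
Proof.
move=> iP UP; have iU : i \notin U by apply: contra iP; apply: (subsetP UP).
set N := ~: [set i]; set V := ~: (P :\: U).
have iV : i \in V by rewrite !inE (negPf iP) andbF.
pose h W := kop (pker (i |: P) W) f.
pose wt W : R := if (U \subset W) && (W \subset P) then C%:R ^+ #|W :\: U| else 0.
have sumJ (F : X -> {set I} -> R) :
    \sum_(j : X * {set I}) (#|{: X}|%:R^-1 * wt j.2) * F j.1 j.2 =
    favg (fun t => \sum_(W : {set I} | (U \subset W) && (W \subset P))
                    C%:R ^+ #|W :\: U| * F t W).
  rewrite /favg mulr_sumr -(pair_bigA _ (fun t W => #|{: X}|%:R^-1 * wt W * F t W)) /=.
  apply: eq_bigr => t _; rewrite mulr_sumr [RHS]big_mkcond; apply: eq_bigr => W _.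
  by rewrite /wt; case: ifP; rewrite ?mulr0 ?mul0r // mulrA.
have VE : ~: ((i |: P) :\: U) = N :&: V.
  apply/setP => j; rewrite !inE; case: (eqVneq j i) => [->|//].
  by rewrite (negPf iU).
have VE2 : (i |: P) :\: (i |: U) = P :\: U.
  apply/setP => j; rewrite !inE; case: (eqVneq j i) => [->|//].
  by rewrite (negPf iP) andbF.
have gl x y t : glue V (glue N x y) t = glue N (glue V x t) y.
  apply/ffunP => j; rewrite !glueE; case: (boolP (j \in N)) => // jN.
  have -> : j = i by move: jN; rewrite !inE negbK => /eqP.
  by rewrite iV.
have WiW W : (U \subset W) && (W \subset P) -> i \notin W.
  by case/andP => _ WP; apply: contra iP; apply: (subsetP WP).
rewrite -[leLHS](favg_cond A_gt0 N) -favgZ -[X in _ <= _ + X](favg_cond A_gt0 N).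
rewrite -favgD; apply: le_favg => x.
(* The vector index is a pair: a sample of the coordinates averaged in L2, and the set [W]. Weight
   and fluctuation are set to 0 off the interval from [U] to [P]. *)
have := @vector_step R p C HC (X * {set I})%type X
  (fun j => #|{: X}|%:R^-1 * wt j.2) (fun j => h j.2 (glue V x j.1))
  (fun j y => if (U \subset j.2) && (j.2 \subset P)
     then h (i |: j.2) (glue V (glue N x y) j.1) else 0) (cube_card_gt0 I A_gt0).
have wt0 (j : X * {set I}) : 0 <= #|{: X}|%:R^-1 * wt j.2.
  rewrite mulr_ge0 ?invr_ge0 ?ler0n // /wt; case: ifP => // _.
  by rewrite exprn_ge0 ?ler0n.
move=> /(_ wt0).
have g0 (j : X * {set I}) : favg (fun y => if (U \subset j.2) && (j.2 \subset P)
     then h (i |: j.2) (glue V (glue N x y) j.1) else 0) = 0.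
  case: (boolP ((U \subset j.2) && (j.2 \subset P))) => _; last by rewrite favg_cst ?cube_card_gt0.
  rewrite -[RHS](cond_lk i (i |: P) j.2 f (glue V x j.1)).
  by apply: eq_favg => y; rewrite gl.
move=> /(_ g0).
have E1 y : \sum_(j : X * {set I}) #|{: X}|%:R^-1 * wt j.2 *
    (h j.2 (glue V x j.1) + (if (U \subset j.2) && (j.2 \subset P)
     then h (i |: j.2) (glue V (glue N x y) j.1) else 0)) ^+ 2 =
    hybrid C%:R P U f (glue N x y).
  rewrite (sumJ (fun t W => (h W (glue V x t) + (if (U \subset W) && (W \subset P)
     then h (i |: W) (glue V (glue N x y) t) else 0)) ^+ 2)).
  apply: eq_favg => t; apply: eq_bigr => W UWP; rewrite UWP.
  have /andP[_ WP] := UWP; rewrite (kop_split _ _ iP WP); congr (_ * (_ + _) ^+ 2).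
  by rewrite -/V gl kop_ek_glue // ?setU11 // WiW.
have E2 : \sum_(j : X * {set I}) #|{: X}|%:R^-1 * wt j.2 *
    h j.2 (glue V x j.1) ^+ 2 = cond V (fun z => \sum_(W : {set I} |
      (U \subset W) && (W \subset P)) C%:R ^+ #|W :\: U| * h W z ^+ 2) x.
  by rewrite (sumJ (fun t W => h W (glue V x t) ^+ 2)).
have E3 y : \sum_(j : X * {set I}) #|{: X}|%:R^-1 * wt j.2 *
    (if (U \subset j.2) && (j.2 \subset P)
     then h (i |: j.2) (glue V (glue N x y) j.1) else 0) ^+ 2 =
    cond V (fun z => \sum_(W : {set I} | (U \subset W) && (W \subset P))
      C%:R ^+ #|W :\: U| * h (i |: W) z ^+ 2) (glue N x y).
  rewrite (sumJ (fun t W => (if (U \subset W) && (W \subset P)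
     then h (i |: W) (glue V (glue N x y) t) else 0) ^+ 2)).
  by apply: eq_favg => t; apply: eq_bigr => W ->.
(* The fluctuation carries the Laplacian at [i], so its sum over [W] is the sum over the sets
   [i |: W] in the hybrid with [i] added to [U]. *)
have E4 y : \sum_(j : X * {set I}) #|{: X}|%:R^-1 * wt j.2 *
    (if (U \subset j.2) && (j.2 \subset P)
     then h (i |: j.2) (glue V (glue N x y) j.1) else 0) ^+ 2 =
    hybrid C%:R (i |: P) (i |: U) f (glue N x y).
  rewrite E3 /hybrid VE2; apply: eq_favg => t; rewrite sum_interval_add1 //.
  apply: eq_bigr => W UWP; congr (C%:R ^+ _ * _).
  congr #|pred_of_set _|; apply/setP => j; rewrite !inE; case: (eqVneq j i) => [->|//].
  by rewrite (negPf (WiW _ UWP)) andbF.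
(* The constant part supplies the sets without [i]; the averaged fluctuation, with its extra factor
   [C], supplies those containing [i]. *)
have E5 : cond V (fun z => \sum_(W : {set I} |
      (U \subset W) && (W \subset P)) C%:R ^+ #|W :\: U| * h W z ^+ 2) x +
    C%:R * favg (fun y => cond V (fun z => \sum_(W : {set I} |
      (U \subset W) && (W \subset P)) C%:R ^+ #|W :\: U| * h (i |: W) z ^+ 2) (glue N x y)) =
    hybrid C%:R (i |: P) U f x.
  rewrite /hybrid VE -cond_cond // -favgZ.
  rewrite -[X in X + _ = _](favg_cst _ (cube_card_gt0 I A_gt0)) -favgD.
  apply: eq_favg => y; rewrite -[C%:R * _]favgZ.
  rewrite /cond -favgD; apply: eq_favg => t.
  rewrite sum_interval_split //; congr (_ + _).
    by apply: eq_bigr => W UWP; rewrite gl /h kop_ek_glue ?setU11 ?WiW.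
  rewrite mulr_sumr; apply: eq_bigr => W UWP; rewrite mulrA -exprS.
  congr (C%:R ^+ _ * _).
  have -> : (i |: W) :\: U = i |: (W :\: U).
    by apply/setP => j; rewrite !inE; case: (eqVneq j i) => [->|//]; rewrite (negPf iU).
  by rewrite cardsU1 inE (negPf (WiW _ UWP)) andbF.
rewrite E2 (eq_favg E3) E5 => H; apply: (le_trans _ (le_trans H _)).
  by apply: le_favg => y; rewrite E1.
by rewrite lerD2l -favgZ; apply: le_favg => y; rewrite E4.
Qed.
End Hybrid.

(** * Noise stability and global hypercontractivity *)

Section Noise.
Variables (R : realFieldType) (I A : finType).
Local Notation X := {ffun I -> A}.
Implicit Types (f g h : X -> R) (U V W P S : {set I}).
Hypothesis A_gt0 : (0 < #|A|)%N.

Definition proj W f : X -> R := kop (@pker R I A setT W) f.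

(** The noise stability of the derivative of [f] in the directions [U] at [x], by [stab_deriv]; the
    exponent omits [U], which the derivative has used up. *)
Definition dstab (s : R) U f x : R :=
  cond U (fun z => \sum_(W : {set I} | U \subset W) s ^+ #|W :\: U| * proj W f z ^+ 2) x.

Definition stab (s : R) f : R := \sum_(W : {set I}) s ^+ #|W| * favg (fun x => proj W f x ^+ 2).

Definition noise (s : R) f : X -> R := kop (fun _ a b => ek R a b + s * lk R a b) f.

Lemma hybrid_setT s U f x : hybrid s setT U f x = dstab s U f x.
Proof.
rewrite /hybrid setTD setCK; apply: eq_favg => y.
by apply: eq_bigl => W; rewrite subsetT andbT.
Qed.

(** Induction on [#|P|]: for empty [P] the hybrid is [f ^+ 2], and adding [i] splits each summand
    [U] into those of [U] and [i |: U]. *)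
Lemma hypercontractive_hybrid (p C : nat) (HC : decoupling_constant R p C) P f :
  favg (fun x => (f x ^+ 2) ^+ p.+1) <=
  \sum_(U : {set I} | U \subset P)
     C%:R ^+ #|U| * favg (fun x => hybrid C%:R P U f x ^+ p.+1).
Proof.
move: {2}#|P| (erefl #|P|) => k; elim: k P => [|k IH] P cP.
  have -> : P = set0 by apply/eqP; rewrite -cards_eq0 cP.
  rewrite (big_pred1 set0) => [|U]; last by rewrite subset0.
  rewrite cards0 mul1r; apply: le_favg => x.
  rewrite /hybrid set0D setC0 condE // (eq_kop (k' := fun=> @idk R A)); last first.
    by move=> i a b; rewrite inE.
  rewrite kop_id (big_pred1 set0) => [|W]; last by rewrite sub0set subset0.
  rewrite set0D cards0 mul1r (eq_kop (k' := fun=> @idk R A)) ?kop_id //.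
  by move=> i a b; rewrite /pker !inE.
have [i iP] : exists i, i \in P by apply/set0Pn; rewrite -cards_eq0 cP.
have i' : i \notin P :\ i by rewrite !inE eqxx.
have cP' : #|P :\ i| = k by move: cP; rewrite (cardsD1 i) iP; lia.
apply: (le_trans (IH _ cP')).
have := @sum_interval_split R I i set0 (P :\ i)
  (fun U => C%:R ^+ #|U| * favg (fun x => hybrid C%:R P U f x ^+ p.+1)) i'.
rewrite inE setD1K // => /(_ isT) E.
rewrite (eq_bigl (fun W => (set0 \subset W) && (W \subset P :\ i))); last first.
  by move=> U; rewrite sub0set.
rewrite [leRHS](eq_bigl (fun W => (set0 \subset W) && (W \subset P))); last first.
  by move=> U; rewrite sub0set.
rewrite E -big_split /=; apply: ler_sum => U /andP[_ UP].
have iU : i \notin U by apply: contra i'; apply: (subsetP UP).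
rewrite cardsU1 iU exprSr -mulrA -mulrDr ler_wpM2l ?exprn_ge0 ?ler0n //.
by have := hybrid_step A_gt0 HC f i' UP; rewrite setD1K.
Qed.

Lemma kop_scale (s : I -> R) (k : I -> A -> A -> R) f x :
  kop (fun i a b => s i * k i a b) f x = (\prod_i s i) * kop k f x.
Proof.
by rewrite /kop mulr_sumr; apply: eq_bigr => y _; rewrite big_split mulrA.
Qed.

Lemma proj_noise s W f x : proj W (noise s f) x = s ^+ #|W| * proj W f x.
Proof.
have -> : s ^+ #|W| = \prod_i (if i \in W then s else 1).
  by rewrite -big_mkcond prodr_const.
rewrite -kop_scale /proj /noise kopM; apply: eq_kop => i a b.
rewrite /pker in_setT; case: ifP => _;
  rewrite (eq_bigr _ (fun c _ => mulrDr _ _ _)) big_split /=.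
  rewrite lk_ek // add0r; under eq_bigr do rewrite mulrCA.
  by rewrite -mulr_sumr lk_lk.
rewrite ek_ek //; under eq_bigr do rewrite mulrCA.
by rewrite -mulr_sumr ek_lk // mulr0 addr0 mul1r.
Qed.

Lemma condZ c U f x : cond U (fun y => c * f y) x = c * cond U f x.
Proof. exact: favgZ. Qed.

Lemma dstab_noise s t U f x :
  dstab s U (noise t f) x = t ^+ (2 * #|U|) * dstab (s * t ^+ 2) U f x.
Proof.
rewrite /dstab -condZ; apply: eq_favg => y; rewrite mulr_sumr; apply: eq_bigr => W UW.
rewrite proj_noise exprMn_comm; last exact: mulrC.
rewrite exprMn -!exprM.
have -> : #|W| = (#|U| + #|W :\: U|)%N by rewrite -(cardsID U W) (setIidPr UW).
rewrite mulnDl exprD (mulnC #|U|) (mulnC #|W :\: U|); ring.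
Qed.

Lemma dstab_ge0 s U f x : 0 <= s -> 0 <= dstab s U f x.
Proof.
move=> s0; apply: cond_ge0 => y; apply: sumr_ge0 => W _.
by rewrite mulr_ge0 ?sqr_ge0 ?exprn_ge0.
Qed.

Lemma le_dstab s t U f x : 0 <= s -> s <= t -> dstab s U f x <= dstab t U f x.
Proof.
move=> s0 st; apply: le_cond => y; apply: ler_sum => W _.
by rewrite ler_wpM2r ?sqr_ge0 // lerXn2r ?nnegrE // (le_trans s0).
Qed.

Lemma le_stab s t f : 0 <= s -> s <= t -> stab s f <= stab t f.
Proof.
move=> s0 st; apply: ler_sum => W _; rewrite ler_wpM2r //.
  by apply: favg_ge0 => x; rewrite sqr_ge0.
by rewrite lerXn2r ?nnegrE // (le_trans s0).
Qed.

(** All coordinates are decoupled by taking [P = setT]; then [dstab_noise] moves the noise into the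
    parameter of the stabilities. *)
Lemma hypercontractive (p C : nat) (HC : decoupling_constant R p C) t f :
  favg (fun x => noise t f x ^+ (2 * p.+1)) <=
  \sum_(U : {set I}) C%:R ^+ #|U| * (t ^+ (2 * #|U|)) ^+ p.+1 *
      favg (fun x => dstab (C%:R * t ^+ 2) U f x ^+ p.+1).
Proof.
have H := hypercontractive_hybrid HC setT (noise t f).
apply: (le_trans (le_trans _ H)).
  by apply: le_favg => x; rewrite exprM.
rewrite (eq_bigl predT) => [|U]; last by rewrite subsetT.
apply: ler_sum => U _; rewrite -mulrA ler_wpM2l ?exprn_ge0 ?ler0n //.
by rewrite -favgZ; apply: le_favg => x; rewrite hybrid_setT dstab_noise exprMn.
Qed.

Lemma sum_subset_exp (k s : R) W :
  \sum_(U : {set I} | U \subset W) k ^+ #|U| * s ^+ #|W :\: U| = (k + s) ^+ #|W|.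
Proof.
have -> : (k + s) ^+ #|W| = \prod_i ((if i \in W then k else 0) + (if i \in W then s else 1)).
  rewrite -prodr_const big_mkcond; apply: eq_bigr => i _.
  by case: ifP => _; rewrite ?add0r.
rewrite bigA_distr big_mkcond; apply: eq_bigr => U _.
case: ifP => [UW|/negbT/subsetPn[i iU iW]]; last first.
  by rewrite (bigD1 i) //= iU (negPf iW) mul0r.
rewrite (bigID (fun i => i \in U)) /=; congr (_ * _).
  rewrite -prodr_const; apply: eq_bigr => i iU.
  by rewrite iU (subsetP UW).
rewrite -prodr_const big_mkcond [RHS]big_mkcond; apply: eq_bigr => i _.
by rewrite inE; case: (i \in U).
Qed.

(** Each [W] is met once for every [U] inside it, and the binomial sum over these [U] merges the
    parameters [k] and [s]. *)
Lemma sum_dstab (k s : R) f :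
  \sum_(U : {set I}) k ^+ #|U| * favg (dstab s U f) = stab (k + s) f.
Proof.
rewrite /stab; transitivity (\sum_(U : {set I}) \sum_(W : {set I} | U \subset W)
   k ^+ #|U| * s ^+ #|W :\: U| * favg (fun x => proj W f x ^+ 2)).
  apply: eq_bigr => U _; rewrite favg_cond // favg_sum mulr_sumr.
  by apply: eq_bigr => W _; rewrite favgZ mulrA.
rewrite (exchange_big_dep predT) //=; apply: eq_bigr => W _.
rewrite -mulr_suml; congr (_ * _).
exact: sum_subset_exp.
Qed.
End Noise.

(** * Derivatives and the level inequality for spread functions *)

Section Holder.
Variable R : realFieldType.

(** An arithmetic-geometric inequality without fractional exponents; the induction step adds
    [(a - h) * (a ^+ q.+1 - h ^+ q.+1) >= 0]. *)
Lemma young_nat (q : nat) (a h : R) : 0 <= a -> 0 <= h ->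
  q.+1%:R * (a ^+ q * h) <= q%:R * a ^+ q.+1 + h ^+ q.+1.
Proof.
move=> a0 h0; elim: q => [|q IH]; first by rewrite expr0 !expr1; lra.
have cross : 0 <= (a - h) * (a ^+ q.+1 - h ^+ q.+1).
  case: (leP h a) => ah.
    by rewrite mulr_ge0 // subr_ge0 // lerXn2r ?nnegrE.
  by rewrite mulr_le0 // subr_le0 ?lerXn2r ?nnegrE // ltW.
have := ler_wpM2l a0 IH.
rewrite -[q.+2]addn1 -[q.+1]addn1 !natrD !addn1.
move: cross; rewrite (exprS a q.+1) (exprS h q.+1) (exprS a q).
set P := a ^+ q; set Q := h ^+ q.+1; set n := q%:R; lra.
Qed.

(** Hoelder's inequality in integer powers: [young_nat] is integrated against [w], with [a] the
    weighted mean of [h]. *)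
Lemma power_mean (T : finType) (q : nat) (w h : T -> R) :
  (forall x, 0 <= w x) -> (forall x, 0 <= h x) ->
  favg (fun x => w x * h x) ^+ q.+1 <= favg w ^+ q * favg (fun x => w x * h x ^+ q.+1).
Proof.
move=> w0 h0; set S := favg (fun x => w x * h x); set W := favg w.
have S0 : 0 <= S by apply: favg_ge0 => x; rewrite mulr_ge0.
have W0 : 0 <= W by apply: favg_ge0.
have rhs0 : 0 <= W ^+ q * favg (fun x => w x * h x ^+ q.+1).
  by rewrite mulr_ge0 ?exprn_ge0 // favg_ge0 // => x; rewrite mulr_ge0 ?exprn_ge0.
case: (eqVneq W 0) => [We|Wn].
  suff -> : S = 0 by rewrite expr0n.
  move: We => /eqP; rewrite mulf_eq0 => /orP[/eqP e|].
    by rewrite /S /favg e mul0r.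
  rewrite psumr_eq0 // => /allP e; rewrite /S /favg big1 ?mulr0 // => x _.
  by have /eqP -> := e x (mem_index_enum x); rewrite mul0r.
have Wp : 0 < W by rewrite lt_def Wn.
set a := S / W; have a0 : 0 <= a by rewrite divr_ge0.
have SE : S = a * W by rewrite /a divfK.
have H : q.+1%:R * a ^+ q * S <= q%:R * a ^+ q.+1 * W + favg (fun x => w x * h x ^+ q.+1).
  rewrite /S /W -!favgZ -favgD; apply: le_favg => x.
  have := ler_wpM2l (w0 x) (young_nat q a0 (h0 x)).
  by move: (a ^+ q) (a ^+ q.+1) (h x ^+ q.+1) => P1 P2 P3; lra.
have K : a ^+ q.+1 * W <= favg (fun x => w x * h x ^+ q.+1).
  by move: H; rewrite SE exprSr -[q.+1]addn1 natrD; set P := a ^+ q; lra.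
have -> : S ^+ q.+1 = W ^+ q * (a ^+ q.+1 * W).
  by rewrite SE exprMn [W ^+ q.+1]exprSr mulrCA.
by rewrite ler_wpM2l ?exprn_ge0.
Qed.
End Holder.

(** * Derivatives and their Efron-Stein components *)

Section Derivative.
Variables (R : realFieldType) (I A : finType).
Local Notation X := {ffun I -> A}.
Implicit Types (f g h : X -> R) (U V W P S T : {set I}).
Hypothesis A_gt0 : (0 < #|A|)%N.

Definition deriv U (x : X) f (y : X) : R := kop (pker R set0 U) f (glue U x y).

(** A component meeting [U] dies, since the derivative is constant in those coordinates. On a
    disjoint one the Laplacians of the derivative are already present in the directions [U]. *)
Lemma proj_deriv W U x f y :
  proj W (deriv U x f) y = if [disjoint W & U] then proj (U :|: W) f (glue U x y) else 0.
Proof.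
rewrite /proj /deriv; case: ifP => [dis|/negbT]; last first.
  rewrite -setI_eq0 => /set0Pn[i]; rewrite inE => /andP[iW iU].
  by apply: (kop_glue0 x (kop (pker R set0 U) f) y iU) => a; rewrite /pker iW sum_lk.
have UW i : i \in U -> i \in W = false.
  move=> iU; apply/negP => iW; move: dis; rewrite -setI_eq0 => /eqP/setP/(_ i).
  by rewrite !inE iU iW.
rewrite (kop_glue1 x (kop (pker R set0 U) f)) => [|i a iU]; last first.
  by rewrite /pker UW // in_setT sum_ek.
rewrite kopM; apply: eq_kop => i a b; rewrite /pker !inE.
case: (boolP (i \in U)) => iU; first by rewrite (sum_idkl (@lk R A)).
by rewrite (sum_idkr (if i \in W then @lk R A else @ek R A)).
Qed.

Lemma glue0 (x y : X) : glue set0 x y = y.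
Proof. by apply/ffunP => i; rewrite glueE inE. Qed.

(** Derivatives in disjoint directions compose. Hence derivatives of an extremal derivative are
    again competitors, which closes the argument of [stab_spread]. *)
Lemma dstab_deriv s V U x f y :
  dstab s V (deriv U x f) y =
  if [disjoint V & U] then dstab s (U :|: V) f (glue U x y) else 0.
Proof.
case: ifP => [dis|/negbT dis]; last first.
  rewrite /dstab /cond -[RHS](favg_cst 0 (cube_card_gt0 I A_gt0)); apply: eq_favg => z.
  rewrite big1 // => W VW; rewrite proj_deriv ifN ?expr0n ?mulr0 //.
  by apply: contra dis; apply: disjointWl.
rewrite /dstab /cond; apply: eq_favg => z; rewrite -glue_glue.
rewrite [RHS](reindex_onto (fun W => U :|: W) (fun W => W :\: U)) /=; last first.
  move=> W; rewrite subUset => /andP[UW _].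
  by apply/setP => i; rewrite !inE; case: (boolP (i \in U)) => //= /(subsetP UW) ->.
rewrite big_mkcond [RHS]big_mkcond; apply: eq_bigr => W _.
rewrite proj_deriv setDUl setDv set0U.
have -> : (W :\: U == W) = [disjoint W & U] by apply/eqP/setDidPl.
case: (boolP [disjoint W & U]) => WU; last by rewrite andbF; case: ifP; rewrite // expr0n mulr0.
rewrite andbT; have -> : (U :|: V \subset U :|: W) = (V \subset W).
  apply/idP/idP => [h|h]; last by rewrite setUS.
  apply/subsetP => i iV; have := subsetP h i; rewrite !inE iV orbT => /(_ isT) /orP[|//].
  by move=> iU; have := disjointFr dis iV; rewrite iU.
case: ifP => // VW; congr (s ^+ _ * _).
congr #|pred_of_set _|; apply/setP => i; rewrite !inE.
case: (boolP (i \in U)) => //= iU; case: (boolP (i \in V)) => //= _.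
by rewrite (disjointFl WU iU).
Qed.

Lemma dstab0 s f x : dstab s set0 f x = stab s f.
Proof.
rewrite /dstab /cond favg_sum; apply: eq_big => [W|W _]; first by rewrite sub0set.
by rewrite setD0 favgZ; congr (_ * _); apply: eq_favg => y; rewrite glue0.
Qed.

Lemma stab_deriv s U x f : stab s (deriv U x f) = dstab s U f x.
Proof.
rewrite -(dstab0 _ _ x) dstab_deriv disjoints_subset sub0set setU0.
by rewrite /dstab cond_glue.
Qed.

Lemma noise_proj s f x : noise s f x = \sum_(W : {set I}) s ^+ #|W| * proj W f x.
Proof.
rewrite /noise /kop; under [RHS]eq_bigr => W _ do rewrite mulr_sumr.
rewrite [RHS]exchange_big; apply: eq_bigr => y _.
under eq_bigr => i _ do rewrite addrC.
rewrite bigA_distr mulr_suml; apply: eq_bigr => W _; rewrite mulrA; congr (_ * _).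
have -> : s ^+ #|W| = \prod_i (if i \in W then s else 1).
  by rewrite -big_mkcond prodr_const.
rewrite -big_split; apply: eq_bigr => i _.
by rewrite /= /pker in_setT; case: ifP => _; rewrite ?mul1r.
Qed.

Lemma proj_proj W f x : proj W (proj W f) x = proj W f x.
Proof.
rewrite /proj kopM; apply: eq_kop => i a b; rewrite /pker in_setT.
by case: ifP => _; rewrite ?lk_lk ?ek_ek.
Qed.

Lemma favg_proj W f g : favg (fun x => f x * proj W g x) = favg (fun x => proj W f x * g x).
Proof.
congr (_ * _); rewrite /proj /kop.
under eq_bigr => x _ do rewrite mulr_sumr.
rewrite exchange_big; apply: eq_bigr => y _; rewrite mulr_suml; apply: eq_bigr => x _.
rewrite mulrCA mulrA; congr (_ * _ * _); apply: eq_bigr => i _.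
by rewrite /pker in_setT; case: ifP => _ //; exact: lkC.
Qed.

Lemma favg_projM W f g :
  favg (fun x => f x * proj W g x) = favg (fun x => proj W f x * proj W g x).
Proof. by rewrite -favg_proj; apply: eq_favg => x; rewrite proj_proj. Qed.

Lemma stab_noise s f : stab s f = favg (fun x => f x * noise s f x).
Proof.
transitivity (favg (fun x => \sum_(W : {set I}) s ^+ #|W| * (f x * proj W f x))).
  by rewrite favg_sum; apply: eq_bigr => W _; rewrite favgZ favg_projM.
apply: eq_favg => x; rewrite noise_proj mulr_sumr; apply: eq_bigr => W _.
by rewrite mulrCA.
Qed.

(** Inclusion-exclusion: expanding [idk - ek] over [U] gives a signed sum of nonnegative conditional
    expectations. *)
Lemma deriv_le U x f y : (forall z, 0 <= f z) ->
  `|deriv U x f y| <= \sum_(T : {set I} | T \subset U) cond (~: T) f (glue U x y).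
Proof.
move=> f0; set z := glue U x y.
have -> : deriv U x f y = \sum_(T : {set I} | T \subset U) (-1) ^+ #|T| * cond (~: T) f z.
  rewrite /deriv -/z.
  rewrite [RHS](eq_bigr (fun T : {set I} => \sum_(t : X) ((-1) ^+ #|T| *
    \prod_i (if i \in ~: T then @idk R A else @ek R A) (z i) (t i)) * f t)); last first.
    move=> T _; rewrite condE // /kop mulr_sumr; apply: eq_bigr => t _; by rewrite mulrA.
  rewrite exchange_big; apply: eq_bigr => t _; rewrite -mulr_suml; congr (_ * _).
  transitivity (\prod_i ((if i \in U then - @ek R A (z i) (t i) else 0) + @idk R A (z i) (t i))).
    apply: eq_bigr => i _; rewrite /pker; case: ifP => _; first by rewrite addrC.
    by rewrite inE add0r.
  rewrite bigA_distr [RHS]big_mkcond; apply: eq_bigr => T _.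
  case: ifP => [TU|/negbT/subsetPn[i iT iU]]; last first.
    by rewrite (bigD1 i) //= iT (negPf iU) mul0r.
  have -> : (-1) ^+ #|T| = \prod_i (if i \in T then -1 else 1) :> R.
    by rewrite -big_mkcond prodr_const.
  rewrite -big_split; apply: eq_bigr => i _ /=; rewrite inE.
  case: (boolP (i \in T)) => iT /=; last by rewrite mul1r.
  by rewrite (subsetP TU) // mulN1r.
apply: (le_trans (ler_norm_sum _ _ _)); apply: ler_sum => T _.
by rewrite normrM normrX normrN1 expr1n mul1r ger0_norm // cond_ge0.
Qed.

Lemma deriv_sup U x f y : (forall z, 0 <= f z <= 1) -> `|deriv U x f y| <= 2 ^+ #|U|.
Proof.
move=> f01; apply: (le_trans (deriv_le _ _ _ _)) => [z|]; first by case/andP: (f01 z).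
have -> : 2 = 1 + 1 :> R by [].
rewrite -sum_subset_exp; apply: ler_sum => T _; rewrite !expr1n mulr1.
rewrite -[leRHS](favg_cst 1 (cube_card_gt0 I A_gt0)); apply: le_favg => z.
by case/andP: (f01 (glue (~: T) (glue U x y) z)).
Qed.

(** Averaging turns each term of [deriv_le] into the density with [U :\: T] fixed; the hypothesis
    bounds it and the binomial sum collects the terms. *)
Lemma deriv_L1 U x f (c mu : R) : (forall z, 0 <= f z) ->
  (forall V y, cond V f y <= c ^+ #|V| * mu) ->
  favg (fun y => `|deriv U x f y|) <= (1 + c) ^+ #|U| * mu.
Proof.
move=> f0 glob; apply: (le_trans (le_favg (fun y => deriv_le U x y f0))).
rewrite favg_sum -sum_subset_exp mulr_suml; apply: ler_sum => T TU.
rewrite -/(cond U (cond (~: T) f) x) cond_cond // expr1n mul1r.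
by rewrite -setDE.
Qed.
End Derivative.

(** * Noise stability of spread functions *)

Section Global.
Variables (R : realFieldType) (I A : finType).
Local Notation X := {ffun I -> A}.
Implicit Types (f g h : X -> R) (U V W P S T : {set I}).
Hypothesis A_gt0 : (0 < #|A|)%N.

Definition spread (c : R) f := forall V y, cond V f y <= c ^+ #|V| * favg f.

Lemma exists_point : exists x0 : X, true.
Proof.
by case: (pickP (fun _ : X => true)) (cube_card_gt0 I A_gt0) => [x _|/eq_card0->//]; exists x.
Qed.

Lemma norm_favg f : `|favg f| <= favg (fun x => `|f x|).
Proof.
rewrite /favg normrM ger0_norm ?invr_ge0 ?ler0n // ler_wpM2l ?invr_ge0 ?ler0n //.
exact: ler_norm_sum.
Qed.

(** For large [p] the bound is nearly [favg f ^+ 2], the level-zero contribution. At a pair [(U, x)]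
    maximising [dstab t U f x * t ^+ (2 * #|U|)], hypercontractivity bounds the norm of the noisy
    derivative by the extremal value itself. *)
Lemma stab_spread (p C : nat) (HC : decoupling_constant R p C) (t c : R) f :
  0 < t -> 2 * C%:R * t <= 1 -> 0 <= c -> 2 * ((1 + c) * t) ^+ 2 <= 1 ->
  (forall x, 0 <= f x <= 1) -> spread c f ->
  stab t f ^+ p.+1 <= favg f ^+ (2 * p).+1.
Proof.
move=> t0 Ct c0 ct f01 fs.
have f0 x : 0 <= f x by case/andP: (f01 x).
have [x0 _] := exists_point; set mu := favg f.
have mu0 : 0 <= mu by apply: favg_ge0.
pose M (j : {set I} * X) := dstab t j.1 f j.2 * t ^+ (2 * #|j.1|).
have [[U x] Umax] : exists j, forall j', M j' <= M j.
  case: (@Order.TotalTheory.arg_maxP _ _ _ (set0, x0) predT M) => // j _ h.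
  by exists j => j'; apply: h.
have tk0 k : 0 < t ^+ k by rewrite exprn_gt0.
set v := dstab t U f x; have v0 : 0 <= v by rewrite dstab_ge0 // ltW.
have start : stab t f <= v * t ^+ (2 * #|U|).
  by have := Umax (set0, x0); rewrite /M /= dstab0 cards0 muln0 mulr1.
(* Maximality of [(U, x)] against the pair [(U :|: V, y)]. *)
have bound V y : [disjoint V & U] -> dstab t (U :|: V) f y <= v / t ^+ (2 * #|V|).
  move=> VU; have := Umax (U :|: V, y); rewrite /M /= cardsU.
  have -> : U :&: V = set0 by apply/eqP; rewrite setI_eq0 disjoint_sym.
  rewrite cards0 subn0 mulnDr exprD mulrA mulrAC ler_pM2r // => h.
  by rewrite ler_pdivlMr.
have C0 : 0 <= C%:R :> R by rewrite ler0n.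
set s := C%:R * t ^+ 2.
have s0 : 0 <= s by rewrite mulr_ge0 // sqr_ge0.
have s2 : s + s <= t.
  by have := ler_wpM2r (ltW t0) Ct; rewrite /s expr2 mul1r; lra.
have st : s <= t by lra.
set g := deriv U x f.
have vE : v = stab t g by rewrite stab_deriv.
have dstabg V y : dstab s V g y <= v / t ^+ (2 * #|V|).
  rewrite dstab_deriv //; case: ifP => VU; last by rewrite divr_ge0 // ltW.
  by apply: (le_trans (le_dstab _ _ _ s0 st)); apply: bound.
(* Of the [p.+1] factors [dstab], [p] are replaced by their maximal value. The remaining ones sum by
   [sum_dstab] to [stab (s + s) g], which is at most [v]. *)
have HCg : favg (fun y => noise t g y ^+ (2 * p.+1)) <= v ^+ p.+1.
  apply: (le_trans (hypercontractive A_gt0 HC t g)).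
  have : v ^+ p * stab (s + s) g <= v ^+ p.+1.
    rewrite exprSr ler_wpM2l ?exprn_ge0 // vE; apply: le_stab => //; lra.
  apply: le_trans; rewrite -sum_dstab // mulr_sumr; apply: ler_sum => V _.
  rewrite -/s; set m := #|V|.
  have -> : C%:R ^+ m * (t ^+ (2 * m)) ^+ p.+1 = s ^+ m * (t ^+ (2 * m)) ^+ p.
    by rewrite exprS mulrA /s exprMn -(exprM t 2 m).
  rewrite -mulrA [leRHS]mulrCA ler_wpM2l ?exprn_ge0 // -!favgZ; apply: le_favg => y.
  have stab_ge0 : 0 <= dstab s V g y by apply: dstab_ge0.
  rewrite exprSr mulrA ler_wpM2r // -exprMn mulrC; apply: lerXn2r; rewrite ?nnegrE //.
    by rewrite mulr_ge0 // ltW.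
  by rewrite -ler_pdivlMr.
(* This is [power_mean] with weight the absolute value of [g]; the weight left under the average is
   at most [2 ^+ #|U|]. *)
have holder : v ^+ (2 * p).+2 <=
    favg (fun y => `|g y|) ^+ (2 * p).+1 * (2 ^+ #|U| * v ^+ p.+1).
  have h1 : v <= favg (fun y => `|g y| * `|noise t g y|).
    rewrite vE stab_noise //; apply: (le_trans (ler_norm _)).
    by apply: (le_trans (norm_favg _)); apply: le_favg => y; rewrite normrM.
  apply: (le_trans (lerXn2r (2 * p).+2 _ _ h1)); rewrite ?nnegrE // ?(le_trans v0 h1) //.
  apply: (le_trans (power_mean _ _ _)) => [y|y|]; rewrite ?normr_ge0 //.
  rewrite ler_wpM2l ?exprn_ge0 ?favg_ge0 //.
  have := ler_wpM2l (exprn_ge0 #|U| (ler0n R 2)) HCg; apply: le_trans.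
  rewrite -favgZ; apply: le_favg => y.
  rewrite -[(2 * p).+2]/(2 + 2 * p)%N -mulnS exprM [in leRHS]exprM real_normK ?num_real //.
  apply: ler_wpM2r; first by rewrite exprn_ge0 ?sqr_ge0.
  exact: deriv_sup.
case: (eqVneq v 0) => [v_eq|vn].
  have -> : stab t f = 0.
    apply/eqP; rewrite eq_le; apply/andP; split.
      by apply: (le_trans start); rewrite v_eq mul0r.
    by rewrite -(dstab0 _ _ x0) dstab_ge0 // ltW.
  by rewrite expr0n exprn_ge0.
have vp : 0 < v by rewrite lt_def vn.
(* Spreadness bounds the L1 norm of [g], and [v ^+ p.+1] is cancelled, for which [v] must be
   nonzero. *)
have vB : v ^+ p.+1 <= ((1 + c) ^+ #|U| * mu) ^+ (2 * p).+1 * 2 ^+ #|U|.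
  have L1 := deriv_L1 A_gt0 U x f0 fs.
  have : v ^+ p.+1 * v ^+ p.+1 <= ((1 + c) ^+ #|U| * mu) ^+ (2 * p).+1 * 2 ^+ #|U| * v ^+ p.+1.
    rewrite -exprD; have -> : (p.+1 + p.+1 = (2 * p).+2)%N by rewrite addSn addnS mul2n addnn.
    apply: (le_trans holder); rewrite mulrA.
    rewrite !ler_wpM2r ?exprn_ge0 // lerXn2r ?nnegrE ?favg_ge0 //.
    by rewrite mulr_ge0 ?exprn_ge0 // addr_ge0.
  by rewrite ler_pM2r // exprn_gt0.
have stab0 : 0 <= stab t f by rewrite -(dstab0 _ _ x0) dstab_ge0 // ltW.
have vt0 : 0 <= v * t ^+ (2 * #|U|) by apply: mulr_ge0 => //; exact: ltW.
apply: (le_trans (lerXn2r _ _ _ start)); rewrite ?nnegrE //.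
rewrite exprMn; apply: (le_trans (ler_wpM2r _ vB)); first by rewrite exprn_ge0 ?(ltW (tk0 _)).
set u := #|U|.
have c1 : 1 <= 1 + c by lra.
have -> : ((1 + c) ^+ u * mu) ^+ (2 * p).+1 * 2 ^+ u * (t ^+ (2 * u)) ^+ p.+1 =
   mu ^+ (2 * p).+1 * (2 * (1 + c) ^+ (2 * p).+1 * t ^+ (2 * p.+1)) ^+ u.
  rewrite !exprMn -!exprM.
  rewrite (mulnC u) [(2 * u * p.+1)%N](_ : _ = 2 * p.+1 * u)%N; last by rewrite mulnAC.
  by move: (_ ^+ _) (_ ^+ _) (_ ^+ _) (_ ^+ _) => a b d e; ring.
rewrite -[leRHS]mulr1 ler_wpM2l ?exprn_ge0 //.
apply: exprn_ile1; first by rewrite !mulr_ge0 ?exprn_ge0 ?(le_trans _ c1) // ltW.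
(* The losses exponential in [#|U|] are paid by the powers of [t] in the maximised quantity. *)
have h : (2 * ((1 + c) * t) ^+ 2) ^+ p.+1 <= 1.
  by apply: exprn_ile1 => //; rewrite mulr_ge0 ?sqr_ge0.
apply: le_trans h; rewrite exprMn -exprM exprMn !mulrA ler_wpM2r ?(ltW (tk0 _)) //.
apply: ler_pM; rewrite ?exprn_ge0 ?(le_trans _ c1) //.
  by rewrite exprS ler_peMr // exprn_ege1 // ler1n.
by apply: ler_weXn2l => //; rewrite mulnS leqW.
Qed.

End Global.

(** * Disagreeing points *)

Section Disagree.
Variables (R : realFieldType) (I A : finType).
Local Notation X := {ffun I -> A}.
Implicit Types (f g h : X -> R) (U V W P S T : {set I}).
Hypothesis A_gt1 : (1 < #|A|)%N.

Let A_gt0 : (0 < #|A|)%N := ltnW A_gt1.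

Lemma proj_set0 f x : proj set0 f x = favg f.
Proof.
rewrite (favg_kop _ x); apply: eq_kop => i a b.
by rewrite /pker !inE.
Qed.

(* [x] and [y] disagree everywhere iff the kernel of [noise (- 1 / (q - 1))] is
   nonzero at [(x, y)], where [q] is the alphabet size. *)
Lemma noise_disagree f g :
  (forall x, 0 <= f x) -> (forall y, 0 <= g y) ->
  (forall x y, 0 < f x -> 0 < g y -> exists i, x i == y i) ->
  favg (fun x => f x * noise (- (#|A|%:R - 1)^-1) g x) = 0.
Proof.
move=> f0 g0 agree; rewrite /favg big1 ?mulr0 // => x _.
case: (eqVneq (f x) 0) => [->|fx]; first by rewrite mul0r.
rewrite /noise /kop big1 ?mulr0 // => y _.
case: (eqVneq (g y) 0) => [->|gy]; first by rewrite mulr0.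
have fp : 0 < f x by rewrite lt_def fx f0.
have gp : 0 < g y by rewrite lt_def gy g0.
have [i /eqP xy] := agree x y fp gp; rewrite (bigD1 i) //= xy /lk /idk /ek eqxx.
have q1 : #|A|%:R - 1 != 0 :> R by rewrite subr_eq0 (eqr_nat R _ 1) gtn_eqF.
have q0 : #|A|%:R != 0 :> R by rewrite pnatr_eq0 -lt0n.
suff -> : #|A|%:R^-1 + - (#|A|%:R - 1)^-1 * (true%:R - #|A|%:R^-1) = 0 :> R by rewrite !mul0r.
by rewrite /=; field; rewrite q0.
Qed.

(** Otherwise the pairing of [f] and [g] through the disagreement operator vanishes. Its level-zero
    term is [favg f * favg g], and the stability bounds make the higher levels too small to cancel
    it. *)
Lemma exists_disagree (t B : R) f g :
  0 < t -> 1 <= t * (#|A|%:R - 1) -> B < t * (#|A|%:R - 1) ->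
  (forall x, 0 <= f x) -> (forall y, 0 <= g y) -> 0 < favg f -> 0 < favg g ->
  stab t f <= B * favg f ^+ 2 -> stab t g <= B * favg g ^+ 2 ->
  exists x y, [/\ 0 < f x, 0 < g y & forall i, x i != y i].
Proof.
move=> t0 t1 tB f0 g0; set a := favg f; set b := favg g => a0 b0 Pf Pg.
set q1 := #|A|%:R - 1 in t1 tB.
have q1p : 0 < q1 by rewrite subr_gt0 ltr1n.
pose ok (j : X * X) := [&& 0 < f j.1, 0 < g j.2 & [forall i, j.1 i != j.2 i]].
case: (pickP ok) => [[x y] /and3P[fx gy /forallP xy]|no]; first by exists x, y.
have Z : favg (fun x => f x * noise (- q1^-1) g x) = 0.
  apply: noise_disagree => // x y fx gy; have := no (x, y); rewrite /ok /= fx gy /=.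
  by move/negbT; rewrite negb_forall => /existsP[i]; rewrite negbK; exists i.
pose nf W := favg (fun x => proj W f x ^+ 2); pose ng W := favg (fun x => proj W g x ^+ 2).
pose fg W := favg (fun x => proj W f x * proj W g x).
have E : \sum_(W : {set I}) (- q1^-1) ^+ #|W| * fg W = 0.
  rewrite -[RHS]Z; transitivity (favg (fun x => \sum_(W : {set I})
      (- q1^-1) ^+ #|W| * (f x * proj W g x))).
    by rewrite favg_sum; apply: eq_bigr => W _; rewrite favgZ favg_projM.
  apply: eq_favg => x; rewrite noise_proj mulr_sumr; apply: eq_bigr => W _.
  by rewrite mulrCA.
(* For nonempty [W] the eigenvalue is at most [(q1 * t)^-1 * t ^+ #|W|] in absolute value, because
   [q1 * t >= 1]; the weights [b ^+ 2] and [a ^+ 2] balance the two functions. *)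
have main W : W != set0 -> - (q1 * t)^-1 * (t ^+ #|W| * (b ^+ 2 * nf W + a ^+ 2 * ng W)) <=
    2 * a * b * ((- q1^-1) ^+ #|W| * fg W).
  move=> W0; set k := #|W|.
  have k0 : (0 < k)%N by rewrite card_gt0.
  have n0 : 0 <= b ^+ 2 * nf W + a ^+ 2 * ng W.
    by rewrite addr_ge0 // mulr_ge0 ?sqr_ge0 //; apply: favg_ge0 => x; rewrite sqr_ge0.
  have h1 : `|2 * a * b * fg W| <= b ^+ 2 * nf W + a ^+ 2 * ng W.
    rewrite /fg /nf /ng -(favgZ (2 * a * b)) -(favgZ (b ^+ 2)) -(favgZ (a ^+ 2)).
    apply: (le_trans (norm_favg _)); rewrite -favgD.
    apply: le_favg => x; move: (proj W f x) (proj W g x) => u v.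
    rewrite ler_norml; have := sqr_ge0 (b * u - a * v); have := sqr_ge0 (b * u + a * v).
    by move=> h2 h3; apply/andP; split; lra.
  have h2 : `|2 * a * b * ((- q1^-1) ^+ k * fg W)| <=
      (q1 * t)^-1 * (t ^+ k * (b ^+ 2 * nf W + a ^+ 2 * ng W)).
    have q1i : 0 <= q1^-1 by rewrite invr_ge0 ltW.
    rewrite mulrCA normrM normrX normrN (ger0_norm q1i) [leRHS]mulrA.
    apply: ler_pM => //; first exact: exprn_ge0.
    have -> : q1^-1 = (q1 * t)^-1 * t by rewrite invfM mulfVK ?gt_eqF.
    have r0 : 0 <= (q1 * t)^-1 by rewrite invr_ge0 mulr_ge0 ?ltW.
    have r1 : (q1 * t)^-1 <= 1 by rewrite invf_le1 ?mulr_gt0 // mulrC.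
    rewrite exprMn; apply: ler_wpM2r; first by rewrite exprn_ge0 ?ltW.
    by rewrite -{1}(prednK k0) exprSr ler_piMl ?exprn_ile1.
  by move: h2; rewrite ler_norml mulNr => /andP[].
have sum_main : - (q1 * t)^-1 * (b ^+ 2 * stab t f + a ^+ 2 * stab t g) <=
    - (2 * a * b * fg set0).
  have := E; rewrite (bigD1 set0) //= cards0 mul1r => E'.
  have -> : - (2 * a * b * fg set0) = 2 * a * b *
      \sum_(W : {set I} | W != set0) (- q1^-1) ^+ #|W| * fg W.
    by rewrite -mulrN; congr (_ * _); apply/eqP; rewrite eq_sym -addr_eq0 addrC E'.
  rewrite [leRHS]mulr_sumr; apply: (@le_trans _ _ (\sum_(W : {set I} | W != set0)
    - (q1 * t)^-1 * (t ^+ #|W| * (b ^+ 2 * nf W + a ^+ 2 * ng W))));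
    last by apply: ler_sum => W; exact: main.
  have -> : b ^+ 2 * stab t f + a ^+ 2 * stab t g =
      \sum_(W : {set I}) t ^+ #|W| * (b ^+ 2 * nf W + a ^+ 2 * ng W).
    rewrite /stab 2!big_distrr -big_split.
    by apply: eq_bigr => W _ /=; rewrite mulrDr; congr (_ + _); rewrite mulrCA.
  have i0 : 0 <= (q1 * t)^-1 by rewrite invr_ge0 mulr_ge0 ?ltW.
  rewrite -[leRHS]mulr_sumr !mulNr lerN2; apply: ler_wpM2l => //.
  rewrite [leRHS](bigD1 set0) //= cards0 expr0 mul1r lerDr.
  by apply: addr_ge0; apply: mulr_ge0; rewrite ?sqr_ge0 //; apply: favg_ge0 => x;
    rewrite sqr_ge0.
have fg0 : fg set0 = a * b.
  rewrite -[RHS](favg_cst _ (cube_card_gt0 I A_gt0)); apply: eq_favg => x.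
  by rewrite !proj_set0.
have q1t : 0 < q1 * t by rewrite mulr_gt0.
have : 2 * (a ^+ 2 * b ^+ 2) * (q1 * t) <= b ^+ 2 * stab t f + a ^+ 2 * stab t g.
  rewrite -ler_pdivlMr // mulrC; move: sum_main; rewrite fg0; lra.
have h1 := ler_wpM2l (sqr_ge0 b) Pf; have h2 := ler_wpM2l (sqr_ge0 a) Pg.
move=> h3; have : (a ^+ 2 * b ^+ 2) * (q1 * t) <= (a ^+ 2 * b ^+ 2) * B by lra.
have ab0 : 0 < a ^+ 2 * b ^+ 2 by apply: mulr_gt0; apply: exprn_gt0.
rewrite ler_pM2l // => h4.
by have := lt_le_trans tB; rewrite mulrC => /(_ _ h4); rewrite ltxx.
Qed.
End Disagree.

(** * Prescribing the number of agreements *)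

Section GoodCoordinates.
Variables (R : realFieldType) (I A : finType).
Local Notation X := {ffun I -> A}.
Implicit Types (f g h : X -> R) (U V W P S T : {set I}).
Hypothesis A_gt0 : (0 < #|A|)%N.

Definition slice f i (a : A) : R := cond [set i] f [ffun=> a].

Definition light f i : {set A} := [set a | slice f i a < favg f / 40].

(** With the proportion one third, two functions that are both good at [i] share a value light for
    neither. *)
Definition bad f : {set I} := [set i | (#|A| <= 3 * #|light f i|)%N].

Lemma cond1E f i x : cond [set i] f x = slice f i (x i).
Proof.
apply: eq_favg => y; congr f; apply/ffunP => j; rewrite !glueE !inE ffunE.
by case: eqP => // ->.
Qed.

Lemma favg_prod (F : I -> A -> R) :
  favg (fun x : X => \prod_i F i (x i)) = \prod_i favg (F i).
Proof.
rewrite /favg -bigA_distr_bigA big_split; congr (_ * _).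
by rewrite prodr_const card_ffun natrX exprVn.
Qed.

Lemma favg_cond_mul f g U : (forall x y, g (glue U x y) = g x) ->
  favg (fun x => f x * g x) = favg (fun x => cond U f x * g x).
Proof.
move=> gU; rewrite -[LHS](favg_cond A_gt0 U); apply: eq_favg => x.
rewrite /cond mulrC -favgZ; apply: eq_favg => y; by rewrite gU mulrC.
Qed.

Lemma favg_light f i : (forall x, 0 <= f x) ->
  favg (fun x => f x * (x i \in light f i)%:R) <= favg f / 40.
Proof.
move=> f0; rewrite (@favg_cond_mul f _ [set i]); last first.
  by move=> x y; rewrite glueE set11.
have mu0 : 0 <= favg f / 40 by rewrite divr_ge0 ?favg_ge0.
rewrite -[leRHS](favg_cst _ (cube_card_gt0 I A_gt0)); apply: le_favg => x.
rewrite cond1E inE; case: ltP; rewrite ?mulr0 // mulr1; exact: ltW.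
Qed.

(* Chernoff: a bad coordinate lies in [light f] with probability at least 1/3 under the uniform
   measure, but at most 1/40 under the measure with density [f]. *)
Lemma bad_le f : (forall x, 0 <= f x <= 1) -> 0 < favg f -> (0 < #|bad f|)%N ->
  favg f / 2 <= (9 / 10) ^+ #|bad f|.
Proof.
move=> f01; set mu := favg f => mu0 n0; set n := #|bad f| in n0 *.
have f0 x : 0 <= f x by case/andP: (f01 x).
pose cnt (x : X) := #|[set i in bad f | x i \in light f i]|.
have cntE x : (cnt x)%:R = \sum_(i in bad f) (x i \in light f i)%:R :> R.
  rewrite /cnt -sum1_card natr_sum (eq_bigl (fun i => (i \in bad f) && (x i \in light f i))).
    by rewrite big_mkcondr; apply: eq_bigr => i _; case: (x i \in light f i).
  by move=> i; rewrite !inE.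
have Ecnt : favg (fun x => f x * (cnt x)%:R) <= n%:R * (mu / 40).
  rewrite (eq_favg (G := fun x => \sum_(i in bad f) f x * (x i \in light f i)%:R)).
    rewrite favg_sum /n -sum1_card natr_sum mulr_suml; apply: ler_sum => i _.
    by rewrite mul1r; apply: favg_light.
  by move=> x; rewrite cntE mulr_sumr.
(* [w] is small enough for [4 / 3 * (2 / 3 + w / 3) <= 9 / 10], and [(4 / 3) ^+ n * w ^+ cnt x] is
   at least 1 once [20 * cnt x <= n]. *)
have [w [wle w0 wE]] : exists w : R, [/\ w <= 1 / 40, 0 <= w & w = (3 / 4) ^+ 20].
  exists ((3 / 4) ^+ 20); split => //; first by rewrite !exprS expr0; lra.
  by rewrite exprn_ge0 // divr_ge0.
(* Points with many light coordinates are charged to a Markov bound, the others to an exponential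
   moment. *)
have pointwise x : f x <= f x * (cnt x)%:R * (20 / n%:R) + (4 / 3) ^+ n * w ^+ cnt x.
  have np : 0 < n%:R :> R by rewrite ltr0n.
  have [h|h] := leqP n (20 * cnt x).
    have le1 : 1 <= (cnt x)%:R * (20 / n%:R) :> R.
      by rewrite mulrA ler_pdivlMr // mul1r mulrC -natrM ler_nat.
    have h2 : f x <= f x * (cnt x)%:R * (20 / n%:R) by rewrite -mulrA ler_peMr.
    have h3 : 0 <= (4 / 3) ^+ n * w ^+ cnt x by rewrite mulr_ge0 ?exprn_ge0 // divr_ge0.
    by apply: (le_trans h2); rewrite lerDl.
  have h1 : 0 <= f x * (cnt x)%:R * (20 / n%:R) by rewrite !mulr_ge0 ?invr_ge0.
  suff : 1 <= (4 / 3) ^+ n * w ^+ cnt x.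
    by move=> h2; rewrite (le_trans _ (lerD h1 h2)) // add0r; case/andP: (f01 x).
  rewrite wE -exprM -(subnK (ltnW h)) exprD -mulrA -exprMn.
  have -> : 4 / 3 * (3 / 4) = 1 :> R by field.
  rewrite expr1n mulr1 exprn_ege1 //; lra.
have := le_favg pointwise; rewrite favgD favgZ -/mu.
rewrite (eq_favg (G := fun x => (20 / n%:R) * (f x * (cnt x)%:R))); last first.
  by move=> x; rewrite mulrC.
rewrite favgZ.
have prodE : favg (fun x => w ^+ cnt x) <= (2 / 3 + w / 3) ^+ n.
  pose F i a := if (i \in bad f) && (a \in light f i) then w else 1.
  rewrite (eq_favg (G := fun x : X => \prod_i F i (x i))); last first.
    move=> x; rewrite /cnt -prodr_const (eq_bigl (fun i => (i \in bad f) && (x i \in light f i))).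
      by rewrite big_mkcond.
    by move=> i; rewrite !inE.
  rewrite favg_prod -prodr_const [leRHS]big_mkcond /F; apply: ler_prod => i _.
  apply/andP; split; first by apply: favg_ge0 => a; case: ifP.
  case: (boolP (i \in bad f)) => ib /=; last by rewrite favg_cst.
  have -> : favg (fun a => if a \in light f i then w else 1) =
      1 - (1 - w) * favg (fun a => (a \in light f i)%:R).
    rewrite -[X in _ = X - _](favg_cst 1 A_gt0) -mulNr -favgZ -favgD.
    by apply: eq_favg => a; case: (a \in light f i) => /=; lra.
  have : 1 / 3 <= favg (fun a => (a \in light f i)%:R : R).
    rewrite /favg -natr_sum -big_mkcond /= sum1_card.
    have q0 : 0 < #|A|%:R :> R by rewrite ltr0n.
    rewrite [leRHS]mulrC ler_pdivlMr //.
    by move: ib; rewrite inE -(ler_nat R) natrM; clear; lra.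
  set e := favg _ => he.
  have : 0 <= (1 - w) * (e - 1 / 3) by apply: mulr_ge0; clear -wle w0 he; lra.
  clear; lra.
have np : 0 < n%:R :> R by rewrite ltr0n.
have h1 : 20 / n%:R * favg (fun x => f x * (cnt x)%:R) <= mu / 2.
  have c0 : 0 <= 20 / n%:R :> R by rewrite divr_ge0.
  apply: (le_trans (ler_wpM2l c0 Ecnt)).
  have -> : 20 / n%:R * (n%:R * (mu / 40)) = mu / 2 by field; rewrite gt_eqF.
  by [].
have h2 : (4 / 3) ^+ n * favg (fun x => w ^+ cnt x) <= (9 / 10) ^+ n.
  have c0 : 0 <= (4 / 3) ^+ n :> R by rewrite exprn_ge0 // divr_ge0.
  apply: (le_trans (ler_wpM2l c0 prodE)); rewrite -exprMn.
  by apply: lerXn2r; rewrite ?nnegrE; clear -wle w0; lra.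
move=> h; have := le_trans h (lerD h1 h2); clear; move: ((9 / 10) ^+ n) => u; lra.
Qed.

(** Here 33 is 3 times 11 and [(9 / 10) ^+ 11 <= 3^-1]: if a third of the coordinates were bad,
    [bad_le] would push [(favg f / 2) ^+ 33] down to [3%:R ^- #|I|]. *)
Lemma card_bad f : (forall x, 0 <= f x <= 1) -> 0 < favg f ->
  (3%:R ^- #|I| < (favg f / 2) ^+ 33) -> (3 * #|bad f| < #|I|)%N.
Proof.
move=> f01 mu0 h; rewrite ltnNge; apply/negP => le.
have mu2 : 0 <= favg f / 2 by rewrite divr_ge0 // ltW.
have f1 : favg f / 2 <= (9 / 10) ^+ #|bad f|.
  case: (posnP #|bad f|) => [->|]; last exact: bad_le.
  rewrite expr0; have : favg f <= 1.
    rewrite -[leRHS](favg_cst 1 (cube_card_gt0 I A_gt0)); apply: le_favg => x.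
    by case/andP: (f01 x).
  lra.
have := lerXn2r 33 mu2 _ f1; rewrite nnegrE exprn_ge0 ?divr_ge0 // => /(_ isT).
rewrite -exprM (_ : #|bad f| * 33 = 11 * (3 * #|bad f|))%N; last by rewrite mulnA mulnC.
rewrite exprM => h2; have := lt_le_trans h h2; apply/negP; rewrite -leNgt.
have b1 : 0 <= (9 / 10) ^+ 11 :> R by rewrite exprn_ge0 // divr_ge0.
have b2 : (9 / 10) ^+ 11 <= 3^-1 :> R by clear -R A_gt0; rewrite !exprS expr0; lra.
have b3 : 3^-1 <= 1 :> R by clear -R A_gt0; lra.
apply: (@le_trans _ _ (3^-1 ^+ (3 * #|bad f|))).
  by apply: lerXn2r; rewrite ?nnegrE // invr_ge0.
rewrite -exprVn; apply: ler_wiXn2l => //; by rewrite invr_ge0.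
Qed.

End GoodCoordinates.

(** * Fixing agreements one coordinate at a time *)

Section Agree.
Variables (R : realFieldType) (I A : finType).
Local Notation X := {ffun I -> A}.
Implicit Types (f g h : X -> R) (U V W P S T : {set I}).
Hypothesis A_gt0 : (0 < #|A|)%N.

Lemma common_slice f g i : i \notin bad f -> i \notin bad g ->
  exists a, favg f / 40 <= slice f i a /\ favg g / 40 <= slice g i a.
Proof.
rewrite !inE -!ltnNge => hf hg.
have h : (#|light f i :|: light g i| < #|A|)%N.
  apply: (leq_ltn_trans (leq_card_setU _ _)); lia.
have /set0Pn[a] : ~: (light f i :|: light g i) != set0.
  by rewrite -card_gt0 cardsCs setCK subn_gt0.
rewrite !inE negb_or -!leNgt => /andP[h1 h2]; by exists a.
Qed.

(** The multiplier [40 * b] pays [b] for one more fixed coordinate and 40 for the loss of density in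
    the slice. *)
Lemma slice_spread f i a (b H : R) : 1 <= b -> 0 <= H -> 0 <= favg f ->
  (forall V y, cond V f y <= H * b ^+ #|V| * favg f) ->
  favg f / 40 <= slice f i a ->
  forall V y, cond V (fun z => f (glue [set i] [ffun=> a] z)) y <=
    (H * (40 * b)) * b ^+ #|V| * slice f i a.
Proof.
move=> b1 H0 mu0 fs fa V y.
have -> : cond V (fun z => f (glue [set i] [ffun=> a] z)) y =
    cond (i |: V) f (glue [set i] [ffun=> a] y).
  by apply: eq_favg => z; rewrite glue_glue.
apply: (le_trans (fs _ _)); have b0 : 0 <= b by lra.
have : b ^+ #|i |: V| <= b * b ^+ #|V|.
  by rewrite -exprS ler_weXn2l // cardsU1; case: (i \in V).
move: (slice f i a) (favg f) (b ^+ #|i |: V|) (b ^+ #|V|) (exprn_ge0 #|V| b0) mu0 fa.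
move=> s mu p q q0 mu0 smu pq.
have h1 : H * p * mu <= H * (b * q) * mu by rewrite ler_wpM2r // ler_wpM2l.
have h2 : H * (b * q) * mu <= H * (b * q) * (40 * s).
  rewrite ler_wpM2l ?mulr_ge0 //; lra.
lra.
Qed.

(** Induction on [s]: a coordinate outside [W], good for both functions, is fixed to a common heavy
    value and then put into [W] so that it is not counted again. After [s] rounds [key] supplies
    points that disagree everywhere. [H] records the loss of spreadness. *)
Lemma agree_exactly (b d c : R) :
  (forall f g, (forall x, 0 <= f x <= 1) -> (forall x, 0 <= g x <= 1) ->
     d <= favg f -> d <= favg g -> spread c f -> spread c g ->
     exists x y, [/\ 0 < f x, 0 < g y & forall i, x i != y i]) ->
  0 < d -> 1 <= b -> 3%:R ^- #|I| < (d / 2) ^+ 33 ->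
  forall s W f g (H : R),
  (forall x, 0 <= f x <= 1) -> (forall x, 0 <= g x <= 1) ->
  d * 40 ^+ s <= favg f -> d * 40 ^+ s <= favg g ->
  1 <= H -> H * (40 * b) ^+ s * b <= c ->
  (forall V y, cond V f y <= H * b ^+ #|V| * favg f) ->
  (forall V y, cond V g y <= H * b ^+ #|V| * favg g) ->
  (3 * (#|W| + s) <= #|I|)%N ->
  exists x y, [/\ 0 < f x, 0 < g y & #|[set i | (i \notin W) && (x i == y i)]| = s].
Proof.
move=> key d0 b1 dn; elim=> [|s IH] W f g H f01 g01 df dg H1 Hc fs gs WI.
  (* For nonempty [V] the constant is absorbed by [H * b ^+ #|V| <= (H * b) ^+ #|V|]; for empty [V]
     the density is [favg h] itself. *)
  have sp h : 0 <= favg h -> (forall V y, cond V h y <= H * b ^+ #|V| * favg h) ->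
      spread c h.
    move=> h0 hs V y; case: (posnP #|V|) => V0.
      move/eqP: V0; rewrite cards_eq0 => /eqP ->; rewrite cards0 mul1r.
      by apply: le_favg => z; rewrite glue0.
    apply: (le_trans (hs V y)); rewrite ler_wpM2r //.
    have Hb : H * b <= c by move: Hc; rewrite expr0 mulr1.
    have Hb0 : 0 <= H * b by rewrite mulr_ge0; lra.
    apply: (@le_trans _ _ ((H * b) ^+ #|V|)); last first.
      by apply: lerXn2r; rewrite ?nnegrE // (le_trans Hb0).
    rewrite exprMn ler_wpM2r ?exprn_ge0 ?(le_trans _ b1) //.
    by rewrite -{1}[H]expr1 ler_weXn2l.
  move: df dg; rewrite expr0 mulr1 => df dg.
  have [||x [y [fx gy xy]]] := key f g f01 g01 df dg.
  - by apply: sp => //; rewrite (le_trans _ df) // ltW.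
  - by apply: sp => //; rewrite (le_trans _ dg) // ltW.
  exists x, y; split => //; apply/eqP; rewrite cards_eq0; apply/eqP/setP => i.
  by rewrite !inE (negPf (xy i)) andbF.
have e1 : 1 <= 40 ^+ s :> R by rewrite exprn_ege1 // ler1n.
have e0 : 0 <= d * 40 ^+ s by rewrite mulr_ge0 ?ltW // (lt_le_trans _ e1).
have big h : d * 40 ^+ s.+1 <= favg h -> d <= favg h /\ d * 40 ^+ s <= favg h / 40.
  rewrite exprS mulrCA => hh; split; last by rewrite ler_pdivlMr // mulrC.
  have : d * 1 <= d * 40 ^+ s by rewrite ler_pM2l.
  by move: hh e0; move: (d * 40 ^+ s) => u; clear; lra.
have [df1 df2] := big _ df; have [dg1 dg2] := big _ dg.
have small h : (forall x, 0 <= h x <= 1) -> d <= favg h -> (3 * #|bad h| < #|I|)%N.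
  move=> h01 dh; apply: (card_bad A_gt0 h01); first exact: lt_le_trans dh.
  have d2 : d / 2 <= favg h / 2 by rewrite ler_pM2r ?invr_gt0.
  have d20 : 0 <= d / 2 by rewrite divr_ge0 // ltW.
  apply: (lt_le_trans dn); apply: lerXn2r; rewrite ?nnegrE //; exact: le_trans d2.
have bf := small f f01 df1; have bg := small g g01 dg1.
(* The two bad sets and [W] each contain less than a third of the coordinates. *)
have /set0Pn[i] : ~: (W :|: (bad f :|: bad g)) != set0.
  rewrite -card_gt0 cardsCs setCK.
  have := (leq_card_setU W (bad f :|: bad g)).1; have := (leq_card_setU (bad f) (bad g)).1.
  move: bf bg WI; rewrite subn_gt0.
  move: #|W :|: _| #|W| #|bad f :|: bad g| #|bad f| #|bad g| #|I| => u1 u2 u3 u4 u5 u6.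
  clear; lia.
rewrite !inE !negb_or => /andP[iW /andP[if_ ig]].
have [a [fa ga]] : exists a, favg f / 40 <= slice f i a /\ favg g / 40 <= slice g i a.
  by apply: common_slice; rewrite !inE.
set fc := fun z => f (glue [set i] [ffun=> a] z).
set gc := fun z => g (glue [set i] [ffun=> a] z).
have [|||||||||x [y [fx gy xy]]] := IH (i |: W) fc gc (H * (40 * b)).
- by move=> x; apply: f01.
- by move=> x; apply: g01.
- exact: le_trans df2 fa.
- exact: le_trans dg2 ga.
- rewrite -[leLHS]mulr1; apply: ler_pM => //; lra.
- by rewrite -(mulrA H) -exprS.
- by apply: slice_spread => //; [lra | rewrite (le_trans _ df1) // ltW].
- by apply: slice_spread => //; [lra | rewrite (le_trans _ dg1) // ltW].
- by move: WI; rewrite cardsU1 iW; move: #|W| #|I| => u1 u2; clear; lia.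
exists (glue [set i] [ffun=> a] x), (glue [set i] [ffun=> a] y); split => //.
rewrite (cardsD1 i) inE iW !glueE set11 eqxx /=; congr (1 + _)%N; rewrite -[RHS]xy.
congr #|pred_of_set _|; apply/setP => j; rewrite !inE !glueE inE.
by case: (eqVneq j i).
Qed.
End Agree.

(** * Choice of parameters in terms of the alphabet size *)

Section SpreadFunctions.
Variable R : realFieldType.

Lemma disagree_spread (t K : nat) : exists b0 : nat, forall (I A : finType) (b : nat)
    (f g : {ffun I -> A} -> R),
  (b0 <= b)%N -> (b ^ (t + 5) <= #|A|)%N -> (#|A| <= b ^ (2 * (t + 5)))%N ->
  (forall x, 0 <= f x <= 1) -> (forall x, 0 <= g x <= 1) ->
  #|A|%:R ^- K <= favg f -> #|A|%:R ^- K <= favg g ->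
  spread (b%:R ^+ (t + 2)) f -> spread (b%:R ^+ (t + 2)) g ->
  exists x y, [/\ 0 < f x, 0 < g y & forall i, x i != y i].
Proof.
(* As [#|A| <= b ^ (2 * e)], a density of at least [#|A|%:R ^- K] is at least [b%:R ^- p]; this
   turns the exponent loss in [stab_spread] into a single factor [b]. *)
set e := (t + 5)%N; pose p := (2 * e * K)%N.
have [C HC] := exists_decoupling_constant R p.
exists (C + 4)%N => I A b f g b0 mb bm f01 g01 df dg sf sg.
have b4 : (4 <= b)%N := leq_trans (leq_addl C 4) b0.
have bC : (C <= b)%N := leq_trans (leq_addr 4 C) b0.
have be (n : nat) : (0 < b ^ n)%N by rewrite expn_gt0 (leq_trans _ b4).
have A0 : (0 < #|A|)%N := leq_trans (be e) mb.
have A1 : (1 < #|A|)%N.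
  apply: leq_trans mb; apply: (leq_trans (ltnW (ltnW b4))).
  by rewrite -{1}[b]expn1 leq_pexp2l // /e ?addnS // (leq_trans _ b4).
set m : R := #|A|%:R in df dg; set c : R := b%:R ^+ (t + 2) in sf sg.
have m0 : 0 < m by rewrite ltr0n.
have bR : 4 <= b%:R :> R by rewrite (ler_nat R 4).
have c1 : b%:R <= c.
  by rewrite /c -[leLHS]expr1 ler_weXn2l ?addnS //; move: bR; clear -R; lra.
have c0 : 0 <= c by apply: le_trans c1.
(* [(1 + c) * tau = 1 / 2] meets the constraints of [stab_spread], while [#|A| >= b ^ (t + 5)] still
   keeps [tau * (#|A| - 1)] above [b]. *)
pose tau : R := (2 * (1 + c))^-1.
have t0 : 0 < tau by rewrite invr_gt0; move: c0; clear -R; lra.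
have ct : (1 + c) * tau = 1 / 2.
  by rewrite /tau; field; rewrite gt_eqF //; move: c0; clear -R; lra.
have mc : b%:R * (2 * (1 + c)) < m - 1.
  have h : (4 * b ^ (t + 3) + 1 < #|A|)%N.
    have E5 : (t + 5 = (t + 3).+2)%N by rewrite !addnS.
    apply: leq_trans mb; rewrite /e E5 expnS expnS.
    have := be (t + 3)%N; move: (b ^ _)%N => B B0.
    have : (4 * B <= b * B)%N by rewrite leq_mul2r b4 orbT.
    have : (4 * (b * B) <= b * (b * B))%N by rewrite leq_mul2r b4 orbT.
    by move: (b * B)%N => D; move: (b * D)%N => E; move: B0; clear; lia.
  have : b%:R * (2 * (1 + c)) <= (4 * b ^ (t + 3))%:R :> R.
    have -> : (4 * b ^ (t + 3))%:R = b%:R * (4 * c) :> R.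
      by rewrite natrM natrX addnS exprS mulrCA.
    rewrite ler_wpM2l //; move: c1 bR; clear -R; lra.
  have : (4 * b ^ (t + 3) + 1)%:R < m by rewrite ltr_nat.
  by rewrite natrD; move: (_%:R) => u; lra.
have tm : b%:R < tau * (m - 1).
  by rewrite /tau mulrC ltr_pdivlMr //; move: c0; clear -R; lra.
have dpos (h : {ffun I -> A} -> R) : m ^- K <= favg h -> 0 < favg h.
  by apply: lt_le_trans; rewrite invr_gt0 exprn_gt0.
have PB (h : {ffun I -> A} -> R) : (forall x, 0 <= h x <= 1) -> m ^- K <= favg h -> spread c h ->
    stab tau h <= b%:R * favg h ^+ 2.
  move=> h01 dh sh; have hp := dpos h dh.
  have Cb : C%:R <= b%:R :> R by rewrite ler_nat.
  have bound : stab tau h ^+ p.+1 <= favg h ^+ (2 * p).+1.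
    apply: (stab_spread A0 HC (c := c)) => //.
      have : C%:R * tau <= (1 + c) * tau.
        by rewrite ler_pM2r //; move: Cb c1; clear -R; lra.
      by rewrite ct -mulrA; clear -R; lra.
    by rewrite ct; clear -R; lra.
  have P0 : 0 <= stab tau h.
    apply: sumr_ge0 => W _; rewrite mulr_ge0 ?exprn_ge0 ?(ltW t0) //.
    by apply: favg_ge0 => x; rewrite sqr_ge0.
  have Q0 : 0 <= b%:R * favg h ^+ 2 by apply: mulr_ge0 => //; exact: sqr_ge0.
  have hk j : 0 <= favg h ^+ j by apply: exprn_ge0; exact: ltW.
  rewrite -(ler_pXn2r (n := p.+1)) ?nnegrE //.
  apply: (le_trans bound); rewrite (exprMn _ b%:R) -exprM.
  rewrite (_ : 2 * p.+1 = (2 * p).+2)%N ?mulnS // [in leRHS](exprS (favg h)) mulrA.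
  rewrite ler_peMl //.
  apply: (@le_trans _ _ (m ^+ K * m ^- K)).
    by rewrite divff // expf_neq0 // gt_eqF.
  have mK : 0 <= m ^+ K by rewrite exprn_ge0 // ltW.
  apply: ler_pM => //; first by rewrite invr_ge0.
  rewrite /m -!natrX ler_nat; apply: (@leq_trans ((b ^ (2 * e)) ^ K)).
    by case: (posnP K) => [->|K0]; rewrite ?expn0 ?leq_exp2r.
  by rewrite -expnM leq_pexp2l // (leq_trans _ b4).
apply: (@exists_disagree R I A A1 tau b%:R) => //.
- by apply: le_trans (ltW tm); move: bR; clear -R; lra.
- by move=> x; case/andP: (f01 x).
- by move=> x; case/andP: (g01 x).
- exact: dpos.
- exact: dpos.
- exact: PB.
- exact: PB.
Qed.

(** A factor [#|A|] absorbs the density loss [2 * 40 ^+ s], and a factor [b] absorbs the same loss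
    of spreadness. The factors 2 in the hypotheses leave room for deleting dictators. *)
Lemma agree_spread (t k : nat) : exists b0 : nat, forall (I A : finType) (b s : nat)
    (W : {set I}) (f g : {ffun I -> A} -> R),
  (b0 <= b)%N -> (b ^ (t + 5) <= #|A|)%N -> (#|A| <= b ^ (2 * (t + 5)))%N ->
  (#|A| ^ (33 * k.+2).+1 <= 3 ^ #|I|)%N ->
  (s <= t)%N -> (3 * (#|W| + s) <= #|I|)%N ->
  (forall x, 0 <= f x <= 1) -> (forall x, 0 <= g x <= 1) ->
  #|A|%:R ^- k <= 2 * favg f -> #|A|%:R ^- k <= 2 * favg g ->
  (forall V y, cond V f y <= 2 * b%:R ^+ #|V| * favg f) ->
  (forall V y, cond V g y <= 2 * b%:R ^+ #|V| * favg g) ->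
  exists x y, [/\ 0 < f x, 0 < g y & #|[set i | (i \notin W) && (x i == y i)]| = s].
Proof.
have [b1 H1] := disagree_spread t k.+1.
exists (b1 + 2 * 40 ^ t)%N => I A b s W f g b0 mb bm mn st Wn f01 g01 df dg sf sg.
have bb1 : (b1 <= b)%N := leq_trans (leq_addr _ _) b0.
have b40 : (2 * 40 ^ t <= b)%N := leq_trans (leq_addl _ _) b0.
have b2 : (2 <= b)%N by apply: leq_trans b40; rewrite leq_pmulr // expn_gt0.
have bA : (b <= #|A|)%N.
  by apply: leq_trans mb; rewrite -{1}[b]expn1 leq_pexp2l ?addnS // ltnW.
have A2 : (2 <= #|A|)%N := leq_trans b2 bA.
have A0 : (0 < #|A|)%N := ltnW A2.
set m : R := #|A|%:R in df dg.
have m0 : 0 < m by rewrite ltr0n.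
have bR : 1 <= b%:R :> R by rewrite ler1n ltnW.
have e1 : 2 * 40 ^+ s <= b%:R :> R.
  apply: (@le_trans _ _ (2 * 40 ^ t)%:R); last by rewrite ler_nat.
  by rewrite natrM natrX ler_pM2l // ler_weXn2l // ler1n.
have dle h : m ^- k <= 2 * favg h -> m ^- k.+1 * 40 ^+ s <= favg h.
  move=> dh; have : m ^- k.+1 * (2 * 40 ^+ s) <= m ^- k.
    rewrite exprSr invfM -mulrA ler_piMr ?invr_ge0 ?exprn_ge0 ?(ltW m0) //.
    rewrite mulrC ler_pdivrMr // mul1r; apply: (le_trans e1).
    by rewrite ler_nat.
  by rewrite mulrCA => h2; have := le_trans h2 dh; rewrite ler_pM2l.
apply: (@agree_exactly R I A A0 b%:R (m ^- k.+1) (b%:R ^+ (t + 2)) _ _ bR _ s W f g 2) => //.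
- by move=> f' g' *; apply: (H1 I A b f' g').
- by rewrite invr_gt0 exprn_gt0.
(* Halving the density costs one more factor [m], whence [k.+2]; the successor in the exponent of
   [#|A|] makes the inequality strict. *)
- apply: (@lt_le_trans _ _ ((m ^- k.+2) ^+ 33)).
    rewrite exprVn -exprM ltf_pV2 ?posrE ?exprn_gt0 // -!natrX ltr_nat.
    by apply: leq_trans mn; rewrite ltn_exp2l // mulnC.
  apply: lerXn2r; rewrite ?nnegrE ?divr_ge0 ?invr_ge0 ?exprn_ge0 ?(ltW m0) //.
  rewrite (exprSr m k.+1) invfM ler_wpM2l ?invr_ge0 ?exprn_ge0 ?(ltW m0) //.
  by rewrite lef_pV2 ?posrE // (ler_nat R 2).
- exact: dle.
- exact: dle.
- by rewrite ler1n.
- rewrite addnS addn1 exprMn mulrA exprSr ler_wpM2r ?(le_trans _ bR) // exprS.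
  apply: ler_pM => //; first by rewrite mulr_ge0 ?exprn_ge0.
    by rewrite exprn_ge0 ?(le_trans _ bR).
  by rewrite ler_weXn2l.
Qed.
End SpreadFunctions.

(** * Uncapturable subcubes *)

Section Junta.
Variables (R : realFieldType) (I A : finType).
Local Notation X := {ffun I -> A}.
Implicit Types (f g h : X -> R) (U V W P S T Z : {set I}).
Hypothesis A_gt0 : (0 < #|A|)%N.
Local Notation m := (#|A|%:R : R).

Let m_gt0 : 0 < m. Proof. by rewrite ltr0n. Qed.

(** A maximiser of [cond S f u / b ^+ #|S|] works: the empty set as competitor gives the density
    bound, larger sets give spreadness. *)
Lemma globalize (b : R) f : 1 <= b -> (forall x, 0 <= f x) ->
  exists S u, favg f * b ^+ #|S| <= cond S f u /\
    forall V y, cond V (fun z => f (glue S u z)) y <= b ^+ #|V| * cond S f u.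
Proof.
move=> b1 f0; have b0 : 0 < b by apply: lt_le_trans b1.
have bk k : 0 < b ^+ k by rewrite exprn_gt0.
have [x0 _] := exists_point I A_gt0.
pose M (j : {set I} * X) := cond j.1 f j.2 / b ^+ #|j.1|.
have [[S u] Smax] : exists j, forall j', M j' <= M j.
  case: (@Order.TotalTheory.arg_maxP _ _ _ (set0, x0) predT M) => // j _ h.
  by exists j => j'; apply: h.
exists S, u; split.
  have := Smax (set0, x0); rewrite /M /= cards0 divr1 ler_pdivlMr //.
  congr (_ * _ <= _); apply: eq_favg => y; by rewrite glue0.
move=> V y; have -> : cond V (fun z => f (glue S u z)) y = cond (S :|: V) f (glue S u y).
  by apply: eq_favg => z; rewrite glue_glue.
have := Smax (S :|: V, glue S u y); rewrite /M /= ler_pdivrMr // => h.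
apply: (le_trans h); rewrite mulrAC ler_pdivrMr //.
rewrite [_ * cond S f u]mulrC -[leRHS]mulrA; apply: ler_wpM2l; first exact: cond_ge0.
by rewrite -exprD ler_weXn2l // addnC; exact: (leq_card_setU S V).1.
Qed.

Lemma favg_point i (a : A) : favg (fun z : X => (z i == a)%:R) = m^-1.
Proof.
have := favg_prod (R := R) (fun j (c : A) => if j == i then (c == a)%:R else 1).
rewrite (bigD1 i) //= [in RHS]big1 => [|j /negPf->]; last by rewrite favg_cst.
rewrite eqxx mulr1 => h; transitivity (favg (fun c : A => (c == a)%:R : R)).
  rewrite -h; apply: eq_favg => z; rewrite (bigD1 i) //= eqxx big1 ?mulr1 // => j /negPf->//.
by rewrite /favg (bigD1 a) //= eqxx big1 ?addr0 ?mulr1 // => c /negPf->.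
Qed.

Definition avoids Z (be : X) : {set X} := [set z : X | [forall i in Z, z i != be i]].

(** Spreadness gives each forbidden value at most the fraction [b / m] of the mass, so by a union
    bound at most half is lost. *)
Lemma avoid_spread (b : R) f Z (be : X) : 0 <= b -> 2 * #|Z|%:R * b <= m ->
  (forall x, 0 <= f x) -> (forall V y, cond V f y <= b ^+ #|V| * favg f) ->
  let f' := fun z => f z * (z \in avoids Z be)%:R in
  favg f <= 2 * favg f' /\ forall V y, cond V f' y <= 2 * b ^+ #|V| * favg f'.
Proof.
move=> b0 Zb f0 fs f'.
have mu0 : 0 <= favg f by apply: favg_ge0.
have pointwise z : f z <= f' z + \sum_(i in Z) f z * (z i == be i)%:R.
  rewrite /f' inE; case: (boolP [forall i in Z, z i != be i]) => [_|].
    by rewrite mulr1 lerDl sumr_ge0 // => i _; rewrite mulr_ge0.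
  rewrite negb_forall => /existsP[i]; rewrite negb_imply negbK => /andP[iZ zi].
  rewrite mulr0 add0r (bigD1 i) //= zi mulr1 lerDl sumr_ge0 // => j _.
  by rewrite mulr_ge0.
have one i : favg (fun z => f z * (z i == be i)%:R) <= b * favg f / m.
  rewrite (@favg_cond_mul R I A A_gt0 f _ [set i]); last first.
    by move=> x y; rewrite glueE set11.
  rewrite -(favg_point i (be i)) -favgZ; apply: le_favg => z.
  by rewrite ler_wpM2r //; have := fs [set i] z; rewrite cards1 expr1.
have half : favg f <= 2 * favg f'.
  have := le_favg pointwise; rewrite favgD favg_sum => h.
  have : \sum_(i in Z) favg (fun z => f z * (z i == be i)%:R) <= favg f / 2.
    apply: (@le_trans _ _ (\sum_(i in Z) b * favg f / m)); first exact: ler_sum.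
    rewrite sumr_const -(mulr_natl (b * favg f / m)) [leLHS]mulrA ler_pdivrMr //.
    have := ler_wpM2r mu0 Zb; move: (favg f) m #|Z|%:R => u v w; clear -R; lra.
  by move: h; move: (favg f) (favg f') (\sum_(i in Z) _) => u v w; clear -R; lra.
split=> // V y; have f'0 x : 0 <= f' x by rewrite mulr_ge0.
apply: (@le_trans _ _ (cond V f y)).
  by apply: le_cond => z; rewrite /f'; case: (z \in _); rewrite ?mulr1 ?mulr0.
apply: (le_trans (fs V y)); rewrite -mulrA [leRHS]mulrCA.
by rewrite ler_wpM2l ?exprn_ge0.
Qed.

(** A choice of [Z] and [be] is a set of at most [l] dictators on free coordinates. The measure is
    taken in the whole cube, not relative to the subcube. *)
Definition uncapturable (F : {set X}) k l (D : {set I} * X) : bool :=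
  [forall Z : {set I}, forall be : X, [disjoint Z & D.1] && (#|Z| <= l)%N ==>
    (m ^- k < favg (fun x => ((x \in F) && [forall i in D.1, x i == D.2 i] &&
                               (x \in avoids Z be))%:R : R))].

(** Density relative to the subcube is no smaller than measure in the cube, and freezing [S] does
    not disturb the avoidance condition on the disjoint set [Z]. *)
Lemma uncapturable_density F k l S (al : X) Z be :
  uncapturable F k l (S, al) -> [disjoint Z & S] -> (#|Z| <= l)%N ->
  m ^- k < favg (fun y => ((glue S al y \in F) && (y \in avoids Z be))%:R).
Proof.
move=> /forallP/(_ Z)/forallP/(_ be); rewrite /= => /implyP h ZS Zl.
apply: (lt_le_trans (h _)); first by rewrite ZS.
pose B x : R := ((x \in F) && (x \in avoids Z be))%:R.
pose D (x : X) : R := [forall i in S, x i == al i]%:R.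
apply: (@le_trans _ _ (cond S B al)); last first.
  apply: le_favg => y; rewrite /B ler_nat; case: (_ \in F) => //=.
  rewrite !inE; case: (boolP [forall i in Z, glue S al y i != be i]) => // /forallP hh.
  suff -> : [forall i in Z, y i != be i] by [].
  apply/forallP => i; apply/implyP => iZ; have /implyP := hh i => /(_ iZ).
  by rewrite glueE (disjointFr ZS iZ).
rewrite (eq_favg (G := fun x => B x * D x)); last first.
  by move=> x; rewrite /B /D -natrM mulnb andbAC.
rewrite (@favg_cond_mul R I A A_gt0 B D S); last first.
  move=> x y; congr (nat_of_bool _)%:R; apply: eq_forallb => i.
  by rewrite glueE; case: (i \in S).
have c0 : 0 <= cond S B al by apply: cond_ge0 => y; rewrite ler0n.
rewrite -[leRHS](favg_cst _ (cube_card_gt0 I A_gt0)); apply: le_favg => x.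
rewrite /D; case: (boolP [forall i in S, x i == al i]) => [/forallP h2|]; last by rewrite mulr0.
rewrite mulr1 le_eqVlt; apply/orP; left; apply/eqP; apply: eq_favg => y; congr B.
by apply/ffunP => i; rewrite !glueE; have /implyP := h2 i; case: (i \in S) => // /(_ isT)/eqP.
Qed.
End Junta.

(** * Agreements between two uncapturable subcubes *)

Section Pair.
Variable R : realFieldType.

(** Fixing [S] gains a factor [b ^+ #|S|], and a density that starts above [#|A|%:R ^- k] cannot
    pass 1; this bounds [#|S|]. *)
Lemma globalize_dense (I A : finType) (b e k : nat) (f : {ffun I -> A} -> R) :
  (0 < #|A|)%N -> (1 < b)%N -> (#|A| <= b ^ e)%N ->
  (forall x, 0 <= f x <= 1) -> #|A|%:R ^- k < favg f ->
  exists (S : {set I}) u, [/\ (#|S| <= e * k)%N,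
    #|A|%:R ^- k <= favg (fun z => f (glue S u z)) &
    forall V y, cond V (fun z => f (glue S u z)) y <=
      b%:R ^+ #|V| * favg (fun z => f (glue S u z))].
Proof.
move=> A0 b2 Ab f01 df.
have m0 : 0 < #|A|%:R :> R by rewrite ltr0n.
have b1 : 1 <= b%:R :> R by rewrite ler1n ltnW.
have f0 x : 0 <= f x by case/andP: (f01 x).
have [S [u [Su SV]]] := globalize A0 b1 f0.
exists S, u; split=> //.
- rewrite -(leq_exp2l _ _ b2); apply: (@leq_trans (#|A| ^ k)); last first.
    by rewrite expnM; case: (posnP k) => [->|k0]; rewrite ?expn0 ?leq_exp2r.
  rewrite -(ler_nat R) !natrX -[leRHS]mul1r -ler_pdivrMr ?exprn_gt0 // mulrC.
  have Su1 : cond S f u <= 1.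
    rewrite -[leRHS](favg_cst 1 (cube_card_gt0 I A0)); apply: le_favg => y.
    by case/andP: (f01 (glue S u y)).
  apply: le_trans Su1; apply: le_trans Su.
  by apply: ler_wpM2r; [rewrite exprn_ge0 // (le_trans _ b1) | exact: ltW].
- apply: (le_trans (ltW df)); apply: le_trans Su.
  by rewrite ler_peMr ?favg_ge0 // exprn_ege1.
Qed.

Lemma pos_nat_of_bool (c : bool) : 0 < (c%:R : R) -> c.
Proof. by case: c; rewrite ?ltxx. Qed.

(** If only [ell < t] fixed coordinates agreed, [F] would contain two points with exactly [t - 1]
    agreements: [ell] on the fixed coordinates and [t - ell - 1] from [agree_spread]. The value of
    [l] bounds [#|P :|: S|], the largest number of dictators avoided through uncapturability. *)
Lemma uncapturable_pair (t k : nat) : exists b0 : nat, forall (I A : finType) (b : nat)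
    (F : {set {ffun I -> A}}) (D D' : {set I} * {ffun I -> A}),
  let l := (k + 2 * (t + 5) * k)%N in
  (b0 <= b)%N -> (b ^ (t + 5) <= #|A|)%N -> (#|A| <= b ^ (2 * (t + 5)))%N ->
  (#|A| ^ (33 * k.+2).+1 <= 3 ^ #|I|)%N -> (3 * (2 * l + t) <= #|I|)%N ->
  (forall x y, x \in F -> y \in F -> #|[set i | x i == y i]|.+1 != t) ->
  (#|D.1| <= k)%N -> (#|D'.1| <= k)%N ->
  uncapturable R F k l D -> uncapturable R F k l D' ->
  (t <= #|[set i in D.1 :&: D'.1 | D.2 i == D'.2 i]|)%N.
Proof.
have [b1 H] := agree_spread R t k; set e := (2 * (t + 5))%N; set ek := (e * k)%N.
exists (b1 + 2 * ek + 2)%N => I A b F [P al] [P' al'] l b0 mb bm mn ln av /= Pk Pk' uD uD'.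
have bb1 : (b1 <= b)%N by apply: leq_trans b0; rewrite -addnA leq_addr.
have bek : (2 * ek <= b)%N by apply: leq_trans b0; rewrite addnAC leq_addl.
have b2 : (1 < b)%N by apply: leq_trans b0; rewrite leq_addl.
have A0 : (0 < #|A|)%N by apply: leq_trans mb; rewrite expn_gt0 ltnW.
have bR : 0 <= b%:R :> R by rewrite ler0n.
rewrite leqNgt; apply/negP; set ell := #|_| => ellt.
have nb01 (c : bool) : 0 <= (c%:R : R) <= 1 by rewrite ler0n lern1; case: c.
(* The first piece avoids the values that the second subcube prescribes on [P' :\: P]. *)
pose f1 y : R := ((glue P al y \in F) && (y \in avoids (P' :\: P) al'))%:R.
have d1 : #|A|%:R ^- k < favg f1.
  apply: (@uncapturable_density R I A A0 F k l P al (P' :\: P) al' uD).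
    by rewrite disjoint_sym disjoints_subset setCD subsetUr.
  by apply: leq_trans (leq_addr _ _); apply: leq_trans Pk'; rewrite subset_leq_card ?subsetDl.
have [S [u [Sk fd fs]]] := globalize_dense A0 b2 bm (fun _ => nb01 _) d1.
(* [beta] holds all values fixed in the first piece; the second piece avoids them off [P']. *)
set beta := glue P al u.
pose g1 y : R := ((glue P' al' y \in F) && (y \in avoids ((P :|: S) :\: P') beta))%:R.
have d2 : #|A|%:R ^- k < favg g1.
  apply: (@uncapturable_density R I A A0 F k l P' al' ((P :|: S) :\: P') beta uD').
    by rewrite disjoint_sym disjoints_subset setCD subsetUr.
  apply: (@leq_trans #|P :|: S|); first by rewrite subset_leq_card ?subsetDl.
  by apply: (leq_trans (leq_card_setU P S).1); rewrite leq_add.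
have [S' [u' [Sk' gd gs]]] := globalize_dense A0 b2 bm (fun _ => nb01 _) d2.
set fP := fun z => f1 (glue S u z) in fd fs.
set gP := fun z => g1 (glue S' u' z) in gd gs.
have fP0 z : 0 <= fP z by apply: ler0n.
have gP0 z : 0 <= gP z by apply: ler0n.
(* Only now is [S'] known, so agreements with [u'] on [S'] are deleted from the first function after
   it has become spread. *)
have [|f2d f2s] := @avoid_spread R I A A0 b%:R fP S' u' bR _ fP0 fs.
  rewrite -natrM -natrM ler_nat; apply: leq_trans mb.
  apply: (@leq_trans (b * b)); first by rewrite leq_mul2r (leq_trans _ bek) ?orbT // leq_mul2l.
  by rewrite mulnn leq_pexp2l ?(ltnW b2) // addnC.
set f2 := fun z => fP z * (z \in avoids S' u')%:R in f2d f2s.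
pose W := (P :|: S) :|: (P' :|: S'); pose s := (t - ell).-1.
have Wl : (#|W| <= 2 * l)%N.
  apply: (leq_trans (leq_card_setU _ _).1); rewrite mul2n -addnn leq_add //.
    by apply: (leq_trans (leq_card_setU _ _).1); rewrite leq_add.
  by apply: (leq_trans (leq_card_setU _ _).1); rewrite leq_add.
have st : (s <= t)%N by rewrite /s (leq_trans (leq_pred _)) ?leq_subr.
have Ws : (3 * (#|W| + s) <= #|I|)%N.
  by apply: leq_trans ln; rewrite leq_mul2l leq_add.
have gP1 : favg gP <= 2 * favg gP by rewrite ler_peMl ?favg_ge0 ?ler1n.
have [||||||x [y [fx gy xy]]] := H I A b s W f2 gP bb1 mb bm mn st Ws.
- by move=> z; rewrite /f2 /fP /f1 -natrM mulnb; apply: nb01.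
- by move=> z; apply: nb01.
- exact: le_trans fd f2d.
- exact: le_trans gd gP1.
- exact: f2s.
- move=> V z; apply: (le_trans (gs V z)).
  by rewrite -mulrA ler_peMl ?ler1n // mulr_ge0 ?exprn_ge0 ?favg_ge0.
move: fx gy; rewrite /f2 /fP /gP /f1 /g1 -natrM mulnb.
move=> /pos_nat_of_bool/andP[/andP[xF]]; rewrite !inE => /forallP fa /forallP fb.
move=> /pos_nat_of_bool/andP[yF] /forallP ga.
set X := glue P al (glue S u x) in xF; set Y := glue P' al' (glue S' u' y) in yF.
have := av X Y xF yF; apply/negP; rewrite negbK.
(* Inside [W] the three avoidance conditions exclude every agreement off [P :&: P']; outside [W] the
   points are [x] and [y]. *)
have : [set i | X i == Y i] = [set i in P :&: P' | al i == al' i] :|: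
   [set i | (i \notin W) && (x i == y i)].
  apply/setP => i; move: (fa i) (fb i) (ga i); rewrite !inE !glueE.
  case: (boolP (i \in P)) => iP; case: (boolP (i \in P')) => iP' /=;
    case: (boolP (i \in S)) => iS; case: (boolP (i \in S')) => iS' /=;
    rewrite ?orbF // => h1 h2 h3; rewrite ?(negPf h1) //; apply/negbTE => //;
    by rewrite eq_sym.
move=> ->; rewrite cardsU xy -/ell.
have -> : [set i in P :&: P' | al i == al' i] :&: [set i | (i \notin W) && (x i == y i)] = set0.
  by apply/setP => i; rewrite /W !inE; case: (i \in P); rewrite ?andbF.
rewrite cards0 subn0 /s; apply/eqP; move: ellt; clear; move: ell => u; lia.
Qed.
End Pair.

(** * Capturing a family by subcubes *)

Section Capture.
Variables (R : realFieldType) (I A : finType).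
Local Notation X := {ffun I -> A}.
Hypothesis A_gt0 : (0 < #|A|)%N.
Local Notation m := (#|A|%:R : R).
Implicit Types (F : {set X}) (D : {set I} * X) (Ds : seq ({set I} * X)).

Let m_gt0 : 0 < m. Proof. by rewrite ltr0n. Qed.

Definition in_sub D (x : X) : bool := [forall i in D.1, x i == D.2 i].

Definition mass (B : X -> bool) : R := favg (fun x => (B x)%:R).

Lemma le_mass (B B' : X -> bool) : (forall x, B x -> B' x) -> mass B <= mass B'.
Proof. by move=> h; apply: le_favg => x; rewrite ler_nat; move: (h x); case: (B x) => // ->. Qed.

Lemma massU (B B1 B2 : X -> bool) :
  (forall x, B x -> B1 x || B2 x) -> mass B <= mass B1 + mass B2.
Proof.
move=> h; rewrite /mass -favgD; apply: le_favg => x; rewrite -natrD ler_nat.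
by move: (h x); case: (B x) (B1 x) (B2 x) => [] [] [] // /(_ isT).
Qed.

Lemma mass0 (B : X -> bool) : (forall x, ~~ B x) -> mass B = 0.
Proof.
move=> h; rewrite -[RHS](favg_cst 0 (cube_card_gt0 I A_gt0)); apply: eq_favg => x.
by rewrite (negPf (h x)).
Qed.

Lemma mass_sub D : mass (in_sub D) = m ^- #|D.1|.
Proof.
have := favg_prod (R := R) (fun i (c : A) => if i \in D.1 then (c == D.2 i)%:R else 1).
rewrite (eq_bigr (fun i => if i \in D.1 then m^-1 else 1)); last first.
  move=> i _; case: (i \in D.1); last by rewrite favg_cst.
  by rewrite /favg (bigD1 (D.2 i)) //= eqxx big1 ?addr0 ?mulr1 // => c /negPf->.
rewrite -big_mkcond prodr_const exprVn => <-; apply: eq_favg => x.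
rewrite /in_sub; case: (boolP [forall i in D.1, x i == D.2 i]) => [/forallP h|].
  by rewrite big1 // => i _; case: ifP => // iD; have /implyP := h i => /(_ iD) ->.
rewrite negb_forall => /existsP[i]; rewrite negb_imply => /andP[iD /negPf xi].
by rewrite (bigD1 i) //= iD xi mul0r.
Qed.

(** One [C] bounds both the number of subcubes and the uncovered mass in units of [m ^- k], so the
    recursion carries a single constant. *)
Definition captured F k l (C : nat) (B : X -> bool) := exists Ds,
  [/\ (size Ds <= C)%N,
      forall D, D \in Ds -> (#|D.1| <= k)%N /\ uncapturable R F k l D
    & mass (fun x => [&& x \in F, B x & ~~ has (in_sub^~ x) Ds]) <= C%:R * m ^- k].

Lemma captured_has F k l C (cs : seq ({set I} * X)) :
  (forall c, c \in cs -> captured F k l C (in_sub c)) ->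
  captured F k l (size cs * C) (fun x => has (in_sub^~ x) cs).
Proof.
elim: cs => [|c cs IH] h.
  by exists [::]; split => //; rewrite mass0 ?mul0r // => x; rewrite /= andbF.
have [|Ds [sDs uDs mDs]] := IH.
  by move=> c' c'cs; apply: h; rewrite inE c'cs orbT.
have [|Es [sEs uEs mEs]] := h c; first by rewrite inE eqxx.
exists (Es ++ Ds); split.
- by rewrite size_cat /= mulSn leq_add.
- by move=> D; rewrite mem_cat => /orP[/uEs|/uDs].
rewrite /= mulSn natrD mulrDl; apply: le_trans (lerD mEs mDs); apply: massU => x.
rewrite has_cat negb_or => /and3P[-> /orP[->|->] /andP[-> ->]] //; by rewrite orbT.
Qed.

(** In codimension at least [k] the subcube is negligible; an uncapturable one covers itself.
    Otherwise some [Z] and [be] capture it up to [m ^- k], the successor in the constant, and each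
    [i] in [Z] opens a branch with one more fixed coordinate. *)
Lemma capture_step F k l C (S : {set I}) (al : X) : (0 < C)%N ->
  ((#|S| < k)%N -> forall i (be : X), i \notin S -> captured F k l C (in_sub (i |: S, be))) ->
  captured F k l (l * C).+1 (in_sub (S, al)).
Proof.
move=> C0 h; have mk : 0 <= m ^- k by rewrite invr_ge0 exprn_ge0 // ltW.
case: (leqP k #|S|) => [kS|Sk].
  exists [::]; split => //; apply: (@le_trans _ _ (m ^- k)).
    apply: (@le_trans _ _ (mass (in_sub (S, al)))).
      by apply: le_mass => x /and3P[].
    rewrite mass_sub /= -!exprVn ler_wiXn2l ?invr_ge0 ?(ltW m_gt0) //.
    by rewrite invf_le1 // ler1n.
  by rewrite ler_peMl // ler1n.
case: (boolP (uncapturable R F k l (S, al))) => [uS|].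
  exists [:: (S, al)]; split => //.
    by move=> D; rewrite inE => /eqP ->; split => //; apply: ltnW.
  rewrite mass0 ?mulr_ge0 // => x; rewrite /= orbF.
  by case: (in_sub _ _); rewrite !andbF.
rewrite negb_forall => /existsP[Z]; rewrite negb_forall => /existsP[be].
rewrite negb_imply -leNgt => /andP[/andP[ZS Zl] small].
have [|Ds [sDs uDs mDs]] := @captured_has F k l C
  [seq (i |: S, glue S al be) | i <- enum Z].
  move=> c /mapP[i iZ ->]; apply: h => //; rewrite mem_enum in iZ.
  by rewrite (disjointFr ZS iZ).
rewrite size_map -cardE in sDs mDs.
have ZC : (#|Z| * C <= l * C)%N by rewrite leq_mul2r Zl orbT.
exists Ds; split => //; first by apply: leqW; apply: leq_trans ZC.
apply: (@le_trans _ _ (m ^- k + (#|Z| * C)%:R * m ^- k)); last first.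
  by rewrite -[X in X + _]mul1r -mulrDl nat1r ler_wpM2r // ler_nat.
apply: le_trans (lerD small mDs); apply: massU => x /and3P[xF xS ->].
rewrite xF -/(in_sub (S, al) x) xS /= andbT inE.
case: (boolP [forall i in Z, x i != be i]) => //=.
rewrite negb_forall => /existsP[i]; rewrite negb_imply negbK => /andP[iZ /eqP xi].
apply/hasP; exists (i |: S, glue S al be); first by apply: map_f; rewrite mem_enum.
apply/forallP => j; apply/implyP; rewrite !inE glueE => /orP[/eqP->|jS].
  by rewrite (disjointFr ZS iZ) xi.
by rewrite jS; have /forallP/(_ j)/implyP := xS; apply.
Qed.
End Capture.

(** Induction on [d], a bound on the depth of branching left before codimension [k]. *)
Lemma capture (R : realFieldType) (k l d : nat) : exists C : nat,
  forall (I A : finType) (F : {set {ffun I -> A}}) (S : {set I}) al,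
  (0 < #|A|)%N -> (k <= #|S| + d)%N -> captured R F k l C (in_sub (S, al)).
Proof.
suff [C [_ H]] : exists C : nat, (0 < C)%N /\
    forall (I A : finType) (F : {set {ffun I -> A}}) (S : {set I}) al,
    (0 < #|A|)%N -> (k <= #|S| + d)%N -> captured R F k l C (in_sub (S, al)).
  by exists C.
elim: d => [|d [C [C0 IH]]].
  exists (l * 1).+1; split=> // I A F S al A0; rewrite addn0 => kS.
  by apply: capture_step => //; rewrite ltnNge kS.
exists (l * C).+1; split=> // I A F S al A0 kS.
apply: capture_step => // _ i be iS; apply: IH => //.
by rewrite cardsU1 iS; move: kS; rewrite addnS.
Qed.

(* Integer roots, logarithms and the final assembly *)
Local Close Scope ring_scope.

(** The integer root of [m] will serve as the spreadness parameter, so that only natural powers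
    occur. *)
Lemma exists_nat_root (e m : nat) : (0 < e)%N -> exists b, (b ^ e <= m < b.+1 ^ e)%N.
Proof.
move=> e0; have ex : exists b, (b ^ e <= m)%N by exists 0%N; rewrite exp0n.
have bd b : (b ^ e <= m)%N -> (b <= m)%N.
  by apply: leq_trans; case: b => // b; rewrite -{1}[b.+1]expn1 leq_pexp2l.
have [b bm bmax] := ex_maxnP ex bd; exists b; rewrite bm ltnNge.
by apply/negP => /bmax; rewrite ltnn.
Qed.

Lemma INR_exp (m n : nat) : INR (m ^ n)%N = pow (INR m) n.
Proof. by elim: n => // n IH; rewrite expnS -multE mult_INR IH. Qed.

Lemma INR_leq (m n : nat) : (m <= n)%N -> Rle (INR m) (INR n).
Proof. by move/ssrnat.leP; apply: le_INR. Qed.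

(** Because [ln 3 >= 1], the logarithmic hypothesis becomes an inequality of natural numbers. *)
Lemma exp_le_of_ln (N m n : nat) : (0 < m)%N ->
  Rle (Rmult (INR N) (ln (INR m))) (INR n) -> (m ^ N <= 3 ^ n)%N.
Proof.
move=> m0 h; rewrite leqNgt; apply/negP => /ssrnat.ltP/lt_INR; rewrite !INR_exp => lt.
have mp : Rlt 0 (INR m) by apply/lt_0_INR/ssrnat.ltP.
have p3 : Rlt 0 (INR 3) by apply/lt_0_INR/ssrnat.ltP.
have := ln_increasing _ _ (pow_lt _ n p3) lt; rewrite !ln_pow // => lt2.
have ln3 : Rle 1 (ln (INR 3)).
  have -> : INR 3 = IZR 3 by rewrite /=; Lra.lra.
  rewrite -[X in Rle X _]ln_exp; case: exp_le_3 => [lt3|->]; last exact: Rle_refl.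
  by apply/Rlt_le/ln_increasing => //; exact: exp_pos.
have := Rmult_le_compat_l _ _ _ (pos_INR n) ln3.
Lra.lra.
Qed.

Theorem theorem6p3 (t k : nat) :
  exists C m0 N : nat,
    forall (m n : nat) (F : {set {ffun 'I_n -> 'I_m}}),
      avoiding t F -> m0 <= m ->
      Rle (Rmult (INR N) (ln (INR m))) (INR n) ->
      exists Ds : seq ({set 'I_n} * {ffun 'I_n -> 'I_m}),
        [/\ t_intersecting t Ds,
            size Ds <= C,
            (forall D, D \in Ds -> codim D <= k)
          & Rle (mu (F :\: bigcup_sub Ds)) (Rdiv (INR C) (pow (INR m) k))].
Proof.
pose l := (k + 2 * (t + 5) * k)%N.
have [b0 pair] := uncapturable_pair rat t k.
have [C cap] := capture rat k l k.
(* The choice of [m0] makes the integer root [b] at least [b0 + 2]. The first summand of [N] yields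
   [n1], the second yields [n2]. *)
exists C, ((b0 + 2) ^ (t + 5))%N, ((33 * k.+2).+1 + 3 * (2 * l + t))%N.
move=> m n F av mm0 mn.
have e0 : (0 < t + 5)%N by rewrite addnC.
have [b /andP[bm mb]] := exists_nat_root m e0.
have bb0 : (b0 + 2 <= b)%N.
  by rewrite -ltnS -(ltn_exp2r _ _ e0); apply: leq_ltn_trans mb.
have b2 : (2 <= b)%N := leq_trans (leq_addl _ _) bb0.
have m3 : (3 <= m)%N.
  apply: leq_trans bm; apply: (@leq_trans (2 ^ (t + 5))); last by rewrite leq_exp2r.
  by apply: (@leq_trans (2 ^ 2)) => //; rewrite leq_pexp2l // addnC.
have m0 : (0 < m)%N by apply: leq_trans m3.
have expmn := exp_le_of_ln m0 mn.
have cm : #|'I_m| = m := card_ord m; have cn : #|'I_n| = n := card_ord n.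
have n1 : (m ^ (33 * k.+2).+1 <= 3 ^ n)%N.
  by apply: leq_trans expmn; rewrite leq_pexp2l // leq_addr.
have n2 : (3 * (2 * l + t) <= n)%N.
  rewrite -(@leq_exp2l 3) //; apply: leq_trans expmn.
  apply: (@leq_trans (m ^ (3 * (2 * l + t)))); last by rewrite leq_pexp2l // leq_addl.
  by case: (posnP (3 * (2 * l + t))) => [->|h] //; rewrite leq_exp2r.
have mb2 : (m <= b ^ (2 * (t + 5)))%N.
  apply: (leq_trans (ltnW mb)); rewrite expnM leq_exp2r //.
  apply: (@leq_trans (b * 2)); last by rewrite -mulnn leq_mul2l b2 orbT.
  by rewrite muln2 -addnn -addn1 leq_add2l ltnW.
pose al : {ffun 'I_n -> 'I_m} := [ffun=> Ordinal m0].
(* The branching starts from the whole cube, where no coordinate is fixed and [al] is a dummy. *)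
have [||Ds [sDs uDs mDs]] := cap 'I_n 'I_m F set0 al; rewrite ?cm ?cards0 //.
exists Ds; split => //.
- move=> D D' DD DD'; have [D1 D2] := uDs D DD; have [D1' D2'] := uDs D' DD'.
  apply: (pair _ _ b F D D') => //; rewrite ?cm ?cn //.
  exact: leq_trans (leq_addr _ _) bb0.
- by move=> D /uDs[].
have cov x : (x \in bigcup_sub Ds) = has (fun D => in_sub D x) Ds.
  rewrite /bigcup_sub; elim: (Ds) => [|D Es IH]; first by rewrite big_nil inE.
  by rewrite big_cons inE IH inE.
(* Masses here are rational while [mu] is real; the bound passes from one to the other as an
   inequality of natural numbers. *)
have key : (#|F :\: bigcup_sub Ds| * m ^ k <= C * m ^ n)%N.
  have mk : (0 < m%:R ^+ k :> rat)%R by rewrite exprn_gt0 // ltr0n.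
  have mn0 : (0 < m%:R ^+ n :> rat)%R by rewrite exprn_gt0 // ltr0n.
  move: mDs; rewrite /mass /favg card_ffun cm cn -natr_sum.
  rewrite (eq_bigr (fun x => (x \in F :\: bigcup_sub Ds) : nat)); last first.
    move=> x _; rewrite inE cov andbC /in_sub; congr nat_of_bool; congr (_ && _).
    suff -> : [forall i in set0, x i == al i] by [].
    by apply/forallP => i; rewrite inE.
  rewrite -big_mkcond sum1_card natrX mulrC ler_pdivrMr // mulrAC ler_pdivlMr //.
  by rewrite -!natrX -!natrM ler_nat.
have mp j : Rlt 0 (pow (INR m) j) by apply: pow_lt; apply/lt_0_INR/ssrnat.ltP.
rewrite /mu INR_exp; apply: (Rmult_le_reg_r _ _ _ (mp n)).
apply: (Rmult_le_reg_r _ _ _ (mp k)).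
have divK (x : R) j : Rmult (Rdiv x (pow (INR m) j)) (pow (INR m) j) = x.
  by rewrite /Rdiv Rmult_assoc Rinv_l ?Rmult_1_r //; apply/Rgt_not_eq/mp.
rewrite divK (Rmult_assoc _ (pow (INR m) n)) (Rmult_comm (pow (INR m) n)) -Rmult_assoc divK.
rewrite -!INR_exp -!mult_INR.
exact: INR_leq.
Qed.
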